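(* Let $T$ be a regular interval exchange transformation defined over a quadratic field. The family of all transformations induced by $T$ on semi-intervals admissible for $T$ contains only finitely many distinct transformations up to equivalence.
   Context: Let $A=\{a_1,\dots,a_s\}$ be a finite alphabet with total orders $<_1$ (with $a_1<_1\cdots<_1a_s$) and $<_2$. An $s$-interval exchange transformation $T$ on $[\ell,r[$ is given by a partition $(I_a)_{a\in A}$ of $[\ell,r[$ into semi-intervals $I_a=[\gamma_a,\mu_a[$ (sets $[\alpha,\beta[=\{z:\alpha\le z<\beta\}$) of lengths $\lambda_a>0$ placed left to right in the order $<_1$; with $\nu_a=\ell+\sum_{b\le_2a}\lambda_b$, $T(z)=z+\nu_a-\mu_a$ on $I_a$. Identifying $a_i$ with $i$, $T$ is encoded as $T_{\lambda,\pi}$ with length vector $\lambda=(\lambda_1,\dots,\lambda_s)$ and the permutation $\pi$ of $\{1,\dots,s\}$ such that the images $T(I_{\pi(1)}),\dots,T(I_{\pi(s)})$ appear from left to right. Two interval exchange transformations $T_{\lambda_1,\pi_1}$, $T_{\lambda_2,\pi_2}$ (on possibly different semi-intervals) are equivalent if $\pi_1=\pi_2$ and $\lambda_1=c\lambda_2$ for some $c>0$. $T$ is defined over a set $Q\subset\mathbb R$ if all $\lambda_a\in Q$; a quadratic field is $\mathbb Q(\sqrt d)$ for a square-free integer $d\ge2$. Write $\gamma_i=\gamma_{a_i}$; $T$ is regular if the orbits $\{T^n(\gamma_i):n\in\mathbb Z\}$, $2\le i\le s$, are infinite and pairwise disjoint; regular implies minimal. For minimal $T$ and a semi-interval $I$,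 the induced transformation on $I$ is $S(z)=T^n(z)$, $n=\min\{n>0:T^n(z)\in I\}$ (it is itself an interval exchange transformation). Admissibility: for $I=[u,v[$ and $z$ let $\rho^+_{I,T}(z)=\min\{n>0:T^n(z)\in\,]u,v[\}$, $\rho^-_{I,T}(z)=\min\{n\ge0:T^{-n}(z)\in\,]u,v[\}$, $E_{I,T}(z)=\{k:-\rho^-_{I,T}(z)\le k<\rho^+_{I,T}(z)\}$, $N_{I,T}(z)=\{T^k(z):k\in E_{I,T}(z)\}$, $\mathrm{Div}(I,T)=\bigcup_{i=1}^sN_{I,T}(\gamma_i)$; $I=[u,v[$ with $\ell\le u<v\le r$ is admissible if $u,v\in\mathrm{Div}(I,T)\cup\{r\}$. *)

(* Defs.v *)
From mathcomp Require Import all_boot all_order all_algebra all_fingroup.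
From mathcomp Require Import all_classical all_reals.
From mathcomp Require Import lra.

Set Implicit Arguments.
Unset Strict Implicit.
Unset Printing Implicit Defensive.

Import Order.TTheory GRing.Theory Num.Theory.

Local Open Scope classical_set_scope.
Local Open Scope ring_scope.

(* Interval exchange transformations T_{lambda,pi} on [iet_left, iet_right[.
   Letters are numbered from left to right (for <_1) by 'I_s, from 0 instead
   of 1; [iet_perm T j] is the letter whose image interval is the j-th one
   from the left, so that a <=_2 b iff pi^-1 a <= pi^-1 b. *)
Record iet (R : realType) := Iet {
  iet_size : nat;
  iet_left : R;
  iet_len : 'I_iet_size -> R;
  iet_perm : 'S_iet_size;
  iet_size_gt0 : (0 < iet_size)%N;
  iet_len_gt0 : forall a, 0 < iet_len a
}.

Arguments iet_len {R} T a : rename.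
Arguments iet_len_gt0 {R} T a : rename.

Definition iet_right (R : realType) (T : iet R) : R :=
  iet_left T + \sum_a iet_len T a.

Definition iet_gamma (R : realType) (T : iet R) (a : 'I_(iet_size T)) : R :=
  iet_left T + \sum_(b < iet_size T | (b < a)%N) iet_len T b.
Arguments iet_gamma {R} T a.

Definition iet_mu (R : realType) (T : iet R) (a : 'I_(iet_size T)) : R :=
  iet_left T + \sum_(b < iet_size T | (b <= a)%N) iet_len T b.
Arguments iet_mu {R} T a.

Definition iet_nu (R : realType) (T : iet R) (a : 'I_(iet_size T)) : R :=
  iet_left T +
  \sum_(b | ((iet_perm T)^-1%g b <= (iet_perm T)^-1%g a)%N) iet_len T b.
Arguments iet_nu {R} T a.

(* The letter a such that z lies in I_a, if any. *)
Definition iet_letter (R : realType) (T : iet R) (z : R) :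
    option 'I_(iet_size T) :=
  [pick a | z \in `[iet_gamma T a, iet_mu T a[].

(* The letter a such that z lies in T(I_a), if any. *)
Definition iet_coletter (R : realType) (T : iet R) (z : R) :
    option 'I_(iet_size T) :=
  [pick a | z \in `[iet_nu T a - iet_len T a, iet_nu T a[].

(* T and its inverse, extended by the identity outside of their domain; they
   are mutually inverse by [iet_funK] and [iet_invK] below. *)
Definition iet_fun (R : realType) (T : iet R) (z : R) : R :=
  if iet_letter T z is Some a then z + iet_nu T a - iet_mu T a else z.

Definition iet_inv (R : realType) (T : iet R) (z : R) : R :=
  if iet_coletter T z is Some a then z - iet_nu T a + iet_mu T a else z.

Lemma iet_sum_cover (R : realType) (s : nat) (l : R) (w : 'I_s -> R)
    (o : 'S_s) (z : R) :
  (0 < s)%N -> l <= z < l + \sum_a w a ->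
  exists a, l + \sum_(b | (o b < o a)%N) w b <= z <
            l + \sum_(b | (o b <= o a)%N) w b.
Proof.
case: s w o => // s w o _ /andP[lz zr].
pose P (a : 'I_s.+1) := l + \sum_(b | (o b < o a)%N) w b <= z.
have P0 : P (o^-1%g ord0) by rewrite /P permKV big_pred0 ?addr0.
case: (@arg_maxnP _ (o^-1%g ord0) P (fun a => o a : nat) P0) => a Pa amax.
exists a; apply/andP; split; first exact: Pa.
rewrite ltNge; apply/negP => za.
have [oas|] := ltnP (o a).+1 s.+1; last first.
  move=> sa; move: zr; rewrite ltNge => /negP; apply; apply: le_trans za.
  rewrite lerD2l le_eqVlt; apply/orP; left; apply/eqP.
  by apply: eq_bigl => b; have := ltn_ord (o b); rewrite ltnS => /leq_trans->.
pose c := o^-1%g (Ordinal oas).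
have oc : o c = (o a).+1 :> nat by rewrite /c permKV.
have /amax : P c.
  by rewrite /P oc; apply: le_trans za; rewrite lerD2l.
by rewrite /= oc ltnn.
Qed.

Lemma iet_sum_split (R : realType) (s : nat) (w : 'I_s -> R) (o : 'S_s) a :
  \sum_(b | (o b <= o a)%N) w b = \sum_(b | (o b < o a)%N) w b + w a.
Proof.
rewrite (bigD1 a) //= addrC; congr (_ + _); apply: eq_bigl => b.
by rewrite ltn_neqAle andbC (inj_eq val_inj) (inj_eq perm_inj).
Qed.

Lemma iet_sum_le (R : realType) (s : nat) (w : 'I_s -> R)
    (P Q : pred 'I_s) :
  (forall a, 0 < w a) -> subpred P Q -> \sum_(b | P b) w b <= \sum_(b | Q b) w b.
Proof.
move=> w0 PQ; rewrite [leRHS](bigID P) /=.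
rewrite [X in X + _](eq_bigl P); last first.
  by move=> b; case: (boolP (P b)) => [/PQ->|]; rewrite ?andbF.
by rewrite lerDl sumr_ge0 // => b _; exact: ltW.
Qed.

Lemma iet_sum_uniq (R : realType) (s : nat) (l : R) (w : 'I_s -> R)
    (o : 'S_s) (z : R) a b : (forall a, 0 < w a) ->
  l + \sum_(c | (o c < o a)%N) w c <= z < l + \sum_(c | (o c <= o a)%N) w c ->
  l + \sum_(c | (o c < o b)%N) w c <= z < l + \sum_(c | (o c <= o b)%N) w c ->
  a = b.
Proof.
move=> w0.
wlog ab : a b / (o a <= o b)%N.
  move=> H ha hb; have [ab|/ltnW ba] := leqP (o a) (o b); first exact: H.
  by apply/esym/H.
move=> /andP[_ za] /andP[bz _]; apply: (@perm_inj _ o); apply: val_inj => /=.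
apply/eqP; rewrite eqn_leq ab leqNgt; apply/negP => ltab.
have h : l + \sum_(c | (o c <= o a)%N) w c <= l + \sum_(c | (o c < o b)%N) w c.
  by rewrite lerD2l; apply: iet_sum_le => // c /= ca; exact: leq_ltn_trans ltab.
by have := lt_le_trans za (le_trans h bz); rewrite ltxx.
Qed.

Lemma iet_sum_range (R : realType) (s : nat) (l : R) (w : 'I_s -> R)
    (o : 'S_s) (z : R) a : (forall a, 0 < w a) ->
  l + \sum_(c | (o c < o a)%N) w c <= z < l + \sum_(c | (o c <= o a)%N) w c ->
  l <= z < l + \sum_a w a.
Proof.
move=> w0 /andP[az za]; apply/andP; split.
  by apply: le_trans az; rewrite lerDl sumr_ge0 // => b _; exact: ltW.
by apply: (lt_le_trans za); rewrite lerD2l; apply: iet_sum_le.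
Qed.

Lemma iet_dom_sumE (R : realType) (T : iet R) (z : R) a :
  (z \in `[iet_gamma T a, iet_mu T a[) =
  (iet_left T + \sum_(c | ((1%g : 'S__) c < (1%g : 'S__) a)%N) iet_len T c <= z
   < iet_left T + \sum_(c | ((1%g : 'S__) c <= (1%g : 'S__) a)%N) iet_len T c).
Proof.
rewrite in_itv /= /iet_gamma /iet_mu.
by congr (_ && _); [congr (_ + _ <= _)|congr (_ < _ + _)];
  apply: eq_bigl => b; rewrite !perm1.
Qed.

Lemma iet_cod_sumE (R : realType) (T : iet R) (z : R) a (o := (iet_perm T)^-1%g) :
  (z \in `[iet_nu T a - iet_len T a, iet_nu T a[) =
  (iet_left T + \sum_(c | (o c < o a)%N) iet_len T c <= z
   < iet_left T + \sum_(c | (o c <= o a)%N) iet_len T c).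
Proof. by rewrite in_itv /= /iet_nu -/o iet_sum_split addrA addrK. Qed.

Lemma iet_letterP (R : realType) (T : iet R) (z : R) a :
  iet_letter T z = Some a <-> z \in `[iet_gamma T a, iet_mu T a[.
Proof.
rewrite /iet_letter; case: pickP => [b zb|h]; last by split => //; rewrite h.
split=> [[<-]//|za]; congr Some; move: za zb; rewrite !iet_dom_sumE.
by move=> za zb; apply: iet_sum_uniq zb za; exact: iet_len_gt0.
Qed.

Lemma iet_coletterP (R : realType) (T : iet R) (z : R) a :
  iet_coletter T z = Some a <-> z \in `[iet_nu T a - iet_len T a, iet_nu T a[.
Proof.
rewrite /iet_coletter; case: pickP => [b zb|h]; last by split => //; rewrite h.
split=> [[<-]//|za]; congr Some; move: za zb; rewrite !iet_cod_sumE.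
by move=> za zb; apply: iet_sum_uniq zb za; exact: iet_len_gt0.
Qed.

Lemma iet_letter_dom (R : realType) (T : iet R) (z : R) :
  (iet_letter T z : bool) = (z \in `[iet_left T, iet_right T[).
Proof.
rewrite in_itv /=; apply/idP/idP.
  case E: (iet_letter T z) => [a|//] _; move/iet_letterP: E.
  by rewrite iet_dom_sumE; apply: iet_sum_range; exact: iet_len_gt0.
move=> /(iet_sum_cover 1%g (iet_size_gt0 T))[a].
by rewrite -iet_dom_sumE => /iet_letterP->.
Qed.

Lemma iet_coletter_dom (R : realType) (T : iet R) (z : R) :
  (iet_coletter T z : bool) = (z \in `[iet_left T, iet_right T[).
Proof.
rewrite in_itv /=; apply/idP/idP.
  case E: (iet_coletter T z) => [a|//] _; move/iet_coletterP: E.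
  by rewrite iet_cod_sumE; apply: iet_sum_range; exact: iet_len_gt0.
move=> /(iet_sum_cover (iet_perm T)^-1%g (iet_size_gt0 T))[a].
by rewrite -iet_cod_sumE => /iet_coletterP->.
Qed.

Lemma iet_muE (R : realType) (T : iet R) a :
  iet_mu T a = iet_gamma T a + iet_len T a.
Proof.
rewrite /iet_mu (bigD1 a) //= [iet_len T a + _]addrC addrA; congr (_ + _ + _).
by apply: eq_bigl => b; rewrite ltn_neqAle andbC.
Qed.

Lemma iet_funK (R : realType) (T : iet R) : cancel (iet_fun T) (iet_inv T).
Proof.
move=> z; rewrite /iet_fun; case E: (iet_letter T z) => [a|]; last first.
  rewrite /iet_inv; case E': (iet_coletter T z) => //.
  by have := iet_coletter_dom T z; rewrite -iet_letter_dom E E'.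
rewrite /iet_inv (_ : iet_coletter _ _ = Some a).
  lra.
by apply/iet_coletterP; move/iet_letterP: E; rewrite iet_muE !in_itv /=; lra.
Qed.

Lemma iet_invK (R : realType) (T : iet R) : cancel (iet_inv T) (iet_fun T).
Proof.
move=> z; rewrite /iet_inv; case E: (iet_coletter T z) => [a|]; last first.
  rewrite /iet_fun; case E': (iet_letter T z) => //.
  by have := iet_letter_dom T z; rewrite -iet_coletter_dom E E'.
rewrite /iet_fun (_ : iet_letter _ _ = Some a).
  lra.
by apply/iet_letterP; move/iet_coletterP: E; rewrite iet_muE !in_itv /=; lra.
Qed.

Definition iet_pow (R : realType) (T : iet R) (k : int) (z : R) : R :=
  match k with
  | Posz n => iter n (iet_fun T) z
  | Negz n => iter n.+1 (iet_inv T) z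
  end.

Definition iet_orbit (R : realType) (T : iet R) (z : R) : set R :=
  [set iet_pow T k z | k in [set: int]].

Definition iet_regular (R : realType) (T : iet R) : Prop :=
  (forall i : 'I_(iet_size T), (0 < i)%N ->
     infinite_set (iet_orbit T (iet_gamma T i))) /\
  (forall i j : 'I_(iet_size T), (0 < i)%N -> (0 < j)%N -> i != j ->
     iet_orbit T (iet_gamma T i) `&` iet_orbit T (iet_gamma T j) = set0).

Definition defined_over (R : realType) (T : iet R) (Q : set R) : Prop :=
  forall a, Q (iet_len T a).

Definition squarefree (d : nat) : Prop :=
  forall k : nat, (k ^ 2 %| d)%N -> k = 1%N.

(* Q(sqrt d) *)
Definition quadratic_field (R : realType) (d : nat) : set R :=
  [set x | exists a b : rat, x = ratr a + ratr b * Num.sqrt d%:R].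

Arguments quadratic_field R d : clear implicits.

Definition defined_over_quadratic_field (R : realType) (T : iet R) : Prop :=
  exists d : nat,
    [/\ (2 <= d)%N, squarefree d & defined_over T (quadratic_field R d)].

(* Equality of the permutations includes equality of the numbers of letters. *)
Definition iet_equiv (R : realType) (T1 T2 : iet R) : Prop :=
  exists e : iet_size T1 = iet_size T2,
    cast_perm e (iet_perm T1) = iet_perm T2 /\
    exists2 c : R, 0 < c &
      forall a, iet_len T1 a = c * iet_len T2 (cast_ord e a).

Definition iet_class (R : realType) (T : iet R) : set (iet R) :=
  [set T' | iet_equiv T T'].

Definition is_min (P : nat -> Prop) (n : nat) : Prop :=
  P n /\ forall m, P m -> (n <= m)%N.

Definition is_rho_plus (R : realType) (T : iet R) (u v z : R) : nat -> Prop :=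
  is_min (fun n => (0 < n)%N /\ iet_pow T n%:Z z \in `]u, v[).

Definition is_rho_minus (R : realType) (T : iet R) (u v z : R) : nat -> Prop :=
  is_min (fun n => iet_pow T (- n%:Z) z \in `]u, v[).

(* E_{I,T}(z) for I = [u, v[. The minimum of an empty set is read as +oo: then
   there is no p (resp. m) and the corresponding bound disappears. *)
Definition iet_E (R : realType) (T : iet R) (u v z : R) : set int :=
  [set k | (forall m, is_rho_minus T u v z m -> - m%:Z <= k) /\
           (forall p, is_rho_plus T u v z p -> k < p%:Z)].

Definition iet_N (R : realType) (T : iet R) (u v z : R) : set R :=
  [set iet_pow T k z | k in iet_E T u v z].

Definition iet_Div (R : realType) (T : iet R) (u v : R) : set R :=
  \bigcup_(i in [set: 'I_(iet_size T)]) iet_N T u v (iet_gamma T i).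

Definition admissible (R : realType) (T : iet R) (u v : R) : Prop :=
  [/\ iet_left T <= u, u < v, v <= iet_right T,
      (iet_Div T u v `|` [set iet_right T]) u &
      (iet_Div T u v `|` [set iet_right T]) v].

Definition is_return_time (R : realType) (T : iet R) (u v z : R) :
    nat -> Prop :=
  is_min (fun n => (0 < n)%N /\ iter n (iet_fun T) z \in `[u, v[).

Definition itinerary (R : realType) (T : iet R) (z : R) (n : nat) :
    seq (option 'I_(iet_size T)) :=
  [seq iet_letter T (iter k (iet_fun T) z) | k <- iota 0 n].

(* S is the transformation induced by T on [u, v[, as an interval exchange
   transformation, that is, as a map together with its partition into
   semi-intervals. Two points are in the same semi-interval of S iff they have
   the same return time and visit the same intervals of T before they return.
   The map alone does not determine the partition: S may be continuous at a
   separation point inherited from T (e.g. when a 3-interval exchange with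
   symmetric permutation induces a rotation with a marked point). *)
Definition is_induced (R : realType) (T : iet R) (u v : R) (S : iet R) : Prop :=
  [/\ iet_left S = u,
      iet_right S = v,
      forall z, z \in `[u, v[ ->
        exists2 n, is_return_time T u v z n &
                   iet_fun S z = iter n (iet_fun T) z &
      forall z z' n n', z \in `[u, v[ -> z' \in `[u, v[ ->
        is_return_time T u v z n -> is_return_time T u v z' n' ->
        (iet_letter S z = iet_letter S z' <->
         itinerary T z n = itinerary T z' n')].

Definition induced_family (R : realType) (T : iet R) : set (iet R) :=
  [set S | exists u v : R, admissible T u v /\ is_induced T u v S].

(* Main.v *)
Require Import Defs.
From mathcomp Require Import all_boot all_order all_algebra all_fingroup.
From mathcomp Require Import all_classical all_reals.
From mathcomp Require Import zify ring lra.

(** A point of an orbit of T has the form l + (p + q sqrt d) / D with integers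
    p, q, and one application of T changes the conjugate p - q sqrt d by a
    bounded amount.  As the norm p^2 - d q^2 of a nonzero number is at least 1
    in absolute value, two distinct points obtained from separation points by
    at most n iterations are at distance at least c / n.

    This repulsion implies that every orbit visits every interval of length e
    within C / e steps.  First, such an interval J contains T^-i(gamma_j) for
    some i <= C / e: otherwise J is translated by T^k into a position
    overlapping J for some k <= (r - l) / e, so it lies in a cylinder of height
    k, which it leaves after boundedly many turns because the area of the
    cylinder bounds its width and repulsion bounds the drift from below.  Second, if J has such
    points as ends and a point first hits J at time m, then for each i < m
    there is an interval of length at least c / (i + N) of points first hitting
    J at time i, N of the order of 1 / e, and these intervals are disjoint, so
    that the divergence of the harmonic series bounds m by a multiple of N.
    That every point hits J at all is Keane's minimality theorem.

    Consequently the separation points of the transformation induced on an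
    admissible interval of length e are reached in at most C / e steps from
    separation points of T, and its lengths, which are at most e, have
    conjugates bounded by C / e.  So the numbers l_a (conjugate of l_b) and
    their conjugates are bounded, and the ratio
    l_a / l_b = l_a (conjugate of l_b) / norm(l_b) takes finitely many values. *)

Set Implicit Arguments.
Unset Strict Implicit.
Unset Printing Implicit Defensive.

Import Order.TTheory GRing.Theory Num.Theory.

Local Open Scope ring_scope.

(** * Disjoint intervals and harmonic sums *)

(** Induction removing the interval with the greatest left end [a m]: the others avoid the point
    [a m], hence lie to its left. *)
Lemma disjoint_itv_sum (R : realType) (I : finType) (A : {set I})
    (a w : I -> R) (l r : R) :
  l <= r -> {in A, forall i, 0 < w i} ->
  {in A, forall i, l <= a i /\ a i + w i <= r} ->
  {in A &, forall i j, i != j ->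
     forall z, ~ (a i <= z < a i + w i /\ a j <= z < a j + w j)} ->
  \sum_(i in A) w i <= r - l.
Proof.
move: {2}#|A| (erefl #|A|) => n; elim: n A r => [|n IH] A r cA lr w0 bd dj.
  move/eqP: cA; rewrite cards_eq0 => /eqP->; rewrite big_set0; lra.
have /card_gt0P[i0 i0A] : (0 < #|A|)%N by rewrite cA.
case: (@arg_maxP _ _ _ i0 (mem A) a i0A) => m mA mmax.
rewrite (big_setD1 m) //=.
have [lm mr] := bd _ mA.
have := w0 _ mA => wm.
have dA i : i \in A :\ m -> i \in A by rewrite !inE => /andP[].
suff : \sum_(i in A :\ m) w i <= a m - l by lra.
apply: IH => //.
- by have := cardsD1 m A; rewrite (mA : m \in A) cA => -[].
- by move=> i /dA /w0.
- move=> i iA; have iA' := dA _ iA; have [li ir] := bd _ iA'; split => //.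
  have im : i != m by move: iA; rewrite !inE => /andP[].
  have := mmax _ iA' => /= aim.
  have := dj _ _ iA' mA im (a m).
  by case: (lerP (a i + w i) (a m)) => // h []; split; apply/andP; split => //; lra.
by move=> i j /dA iA /dA jA; exact: dj.
Qed.

(** Dyadic blocks: the [q = 2^k N] terms from index [m = (2^k - 1) N] on have denominators at most
    [2 q], so they add at least 1/2. *)
Lemma harmonic_ge (R : realType) (N k : nat) : (0 < N)%N ->
  k%:R / 2 <= \sum_(0 <= i < (2 ^ k - 1) * N) ((i + N)%:R)^-1 :> R.
Proof.
move=> N0; elim: k => [|k IH].
  by rewrite mul0r sumr_ge0 // => i _; rewrite invr_ge0.
have k0 : (0 < 2 ^ k)%N by rewrite expn_gt0.
rewrite (@big_cat_nat _ _ _ ((2 ^ k - 1) * N)%N) //=; last first.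
  by rewrite leq_mul2r leq_sub2r ?orbT // leq_exp2l.
rewrite -natr1 mulrDl lerD // ?mul1r.
have -> : ((2 ^ k.+1 - 1) * N = (2 ^ k - 1) * N + 2 ^ k * N)%N.
  by rewrite -mulnDl expnS; congr (_ * _)%N; lia.
set m := ((2 ^ k - 1) * N)%N; set q := (2 ^ k * N)%N.
have q0 : (0 < q)%N by rewrite muln_gt0 k0.
have mq : (m + N = q)%N by rewrite /m /q mulnBl mul1n subnK // leq_pmull.
apply: (@le_trans _ _ (\sum_(m <= i < m + q) ((2 * q)%:R)^-1)).
  rewrite sumr_const_nat addKn natrM invfM -[leRHS]mulr_natr -mulrA mulVf ?mulr1 //.
  by rewrite pnatr_eq0 -lt0n.
apply: ler_sum_nat => i /andP[_ iq].
rewrite lef_pV2 ?posrE ?ltr0n ?ler_nat; lia.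
Qed.

(** [M] is a power of 2 depending only on [c] and [L], as shifting the series by [N] lengthens the
    dyadic blocks in proportion to [N]. *)
Lemma harmonic_bound (R : realType) (c L : R) : 0 < c ->
  exists M : nat, forall N n : nat, (0 < N)%N ->
    \sum_(i < n) c / (i + N)%:R <= L -> (n <= M * N)%N.
Proof.
move=> c0; pose k := Num.bound (`|L| * 2 / c).
have kP : `|L| * 2 / c < k%:R by apply: archi_boundP; rewrite !mulr_ge0 // invr_ge0 ltW.
exists (2 ^ k)%N => N n N0 sL; rewrite leqNgt; apply/negP => nM.
have le : ((2 ^ k - 1) * N <= n)%N.
  by apply: leq_trans (ltnW nM); rewrite leq_mul2r leq_subr orbT.
have := harmonic_ge R k N0.
have : \sum_(0 <= i < (2 ^ k - 1) * N) ((i + N)%:R : R)^-1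
    <= \sum_(0 <= i < n) (i + N)%:R^-1.
  rewrite [leRHS](@big_cat_nat _ _ _ ((2 ^ k - 1) * N)%N) //= lerDl sumr_ge0 // => i _.
  by rewrite invr_ge0.
rewrite [in X in _ <= X -> _]big_mkord => h1 h2.
have h : c * (k%:R / 2) <= L.
  apply: le_trans sL; rewrite -mulr_sumr ler_pM2l //; exact: le_trans h1.
move: kP; rewrite ltr_pdivrMr //; have := ler_norm L; lra.
Qed.

(** The cell of [z] in the subdivision of [l, r[ by [D]: each new point of [D] moves at most one end
    of it. *)
Lemma cell_exists (R : realType) (D : seq R) (l r z : R) : l <= z < r ->
  exists p q, [/\ l <= p <= z, z < q <= r, p \in l :: D, q \in r :: D &
    forall e, e \in D -> ~ (p < e < q)].
Proof.
move=> /andP[lz zr]; elim: D => [|e D [p [q [pz qz pD qD H]]]].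
  by exists l, r; rewrite !mem_head lexx lz zr lexx.
have pD' : p \in l :: e :: D by move: pD; rewrite !inE => /orP[]->; rewrite ?orbT.
have qD' : q \in r :: e :: D by move: qD; rewrite !inE => /orP[]->; rewrite ?orbT.
case: (boolP (p < e <= z)) => [/andP[pe ez]|he].
  exists e, q; split => //; rewrite ?inE ?eqxx ?orbT //; first by lra.
  move=> e'; rewrite inE => /orP[/eqP->|/H]; lra.
case: (boolP (z < e < q)) => [/andP[ze eq]|he'].
  exists p, e; split => //; rewrite ?inE ?eqxx ?orbT //; first by lra.
  move=> e'; rewrite inE => /orP[/eqP->|/H]; lra.
exists p, q; split => // e'; rewrite inE => /orP[/eqP-> h|/H//]; lra.
Qed.

(** * Numbers with bounded conjugate *)

(* [lat D d B x]: x lies in (Z + Z sqrt d) / D, and the conjugate of D x is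
   bounded by B. *)
Definition lat (R : realType) (D d : nat) (B x : R) :=
  exists p q : int, D%:R * x = p%:~R + q%:~R * Num.sqrt d%:R /\
    `|p%:~R - q%:~R * Num.sqrt d%:R| <= B.

Section Lattice.
Variables (R : realType) (D d : nat).
Hypothesis D_gt0 : (0 < D)%N.
Hypothesis d_nonsquare : forall p q : int, p ^+ 2 = d%:Z * q ^+ 2 -> q = 0.
Local Notation sd := (Num.sqrt d%:R : R).
Local Notation lat := (@lat R D d).
Implicit Types x y B : R.

Lemma lat_ge0 B x : lat B x -> 0 <= B.
Proof. by move=> [p [q [_ h]]]; apply: le_trans h. Qed.

Lemma lat_le B B' x : B <= B' -> lat B x -> lat B' x.
Proof. by move=> le [p [q [e h]]]; exists p, q; split => //; exact: le_trans le. Qed.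

Lemma lat0 : lat 0 0.
Proof. by exists 0, 0; rewrite !mul0r subr0 addr0 mulr0 normr0. Qed.

Lemma latN B x : lat B x -> lat B (- x).
Proof.
move=> [p [q [e h]]]; exists (- p), (- q); split.
  by rewrite mulrN e !mulrNz mulNr opprD.
by rewrite !mulrNz mulNr -opprD normrN.
Qed.

Lemma latD B B' x y : lat B x -> lat B' y -> lat (B + B') (x + y).
Proof.
move=> [p [q [e h]]] [p' [q' [e' h']]]; exists (p + p'), (q + q'); split.
  by rewrite mulrDr e e' !mulrzDr mulrDl addrACA.
apply: le_trans (le_trans (ler_normD _ _) (lerD h h')).
by rewrite !mulrzDr mulrDl opprD addrACA.
Qed.

Lemma latB B B' x y : lat B x -> lat B' y -> lat (B + B') (x - y).
Proof. by move=> hx /latN; exact: latD. Qed.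

Lemma lat_sum (I : finType) (P : pred I) (F : I -> R) B :
  0 <= B -> (forall i, lat B (F i)) -> lat (#|I|%:R * B) (\sum_(i | P i) F i).
Proof.
move=> B0 hF; rewrite mulr_natl -sumr_const.
have le : \sum_(i | P i) B <= \sum_(i : I) B.
  by rewrite big_mkcond; apply: ler_sum => i _; case: ifP.
apply: (lat_le le).
by elim/big_rec2: _ => [|i b s _ h]; [exact: lat0|exact: latD].
Qed.

Lemma sqrt_nat_sq : sd ^+ 2 = d%:R.
Proof. by rewrite sqr_sqrtr // ler0n. Qed.

Lemma norm_neq0 x (p q : int) : x != 0 -> D%:R * x = p%:~R + q%:~R * sd ->
  p ^+ 2 - d%:Z * q ^+ 2 != 0.
Proof.
move=> x0 e; apply/negP => /eqP /subr0_eq h.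
have q0 := d_nonsquare h; move: h; rewrite q0 [0 ^+ 2]expr2 !mulr0 => /eqP.
rewrite sqrf_eq0 => /eqP p0; move/eqP: e.
by rewrite p0 q0 mul0r addr0 mulf_eq0 (negPf x0) orbF pnatr_eq0 -leqn0 leqNgt D_gt0.
Qed.

(** [D x] times its conjugate is the norm [p^2 - d q^2], a nonzero integer. This is the repulsion
    principle: a small nonzero number has a large conjugate. *)
Lemma lat_lower B x : lat B x -> x != 0 -> 1 <= D%:R * B * `|x|.
Proof.
move=> [p [q [e h]]] x0; have n0 := norm_neq0 x0 e.
have : (1 : R) <= `|(p ^+ 2 - d%:Z * q ^+ 2)%:~R|.
  by rewrite -intr_norm ler1z -gtz0_ge1 normr_gt0.
have -> : (p ^+ 2 - d%:Z * q ^+ 2)%:~R = (D%:R * x) * (p%:~R - q%:~R * sd) :> R.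
  rewrite e [RHS](_ : _ = p%:~R ^+ 2 - sd ^+ 2 * q%:~R ^+ 2); last by ring.
  by rewrite sqrt_nat_sq !expr2 mulrzBr !intrM.
rewrite !normrM normr_nat => h1; apply: (le_trans h1).
by rewrite mulrAC ler_wpM2r // ler_wpM2l.
Qed.

(** Numerator and denominator are multiplied by the conjugate of [D y]: [Z] is the norm of [D y],
    and both [X + Y sqrt d] and its conjugate are bounded by [W], hence so are [X] and [Y]. *)
Lemma lat_ratio B B' x y W : (0 < d)%N -> y != 0 ->
  lat B x -> lat B' y ->
  D%:R * `|x| * B' <= W -> D%:R * `|y| * B <= W -> D%:R * `|y| * B' <= W ->
  exists X Y Z : int, x / y = (X%:~R + Y%:~R * sd) / Z%:~R /\
    [/\ `|X|%:~R <= W, `|Y|%:~R <= W & `|Z|%:~R <= W].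
Proof.
move=> d0 y0 [p [q [e h]]] [p' [q' [e' h']]] h1 h2 h3.
have n0 := norm_neq0 y0 e'.
pose X := p * p' - q * q' * d%:Z; pose Y := q * p' - p * q'.
pose Z := p' ^+ 2 - d%:Z * q' ^+ 2.
have sq := sqrt_nat_sq.
have eZ : Z%:~R = (D%:R * y) * (p'%:~R - q'%:~R * sd) :> R.
  rewrite e' [RHS](_ : _ = p'%:~R ^+ 2 - sd ^+ 2 * q'%:~R ^+ 2); last by ring.
  by rewrite sq /Z !expr2 mulrzBr !intrM.
have eX : X%:~R + Y%:~R * sd = (D%:R * x) * (p'%:~R - q'%:~R * sd).
  rewrite e [RHS](_ : _ = p%:~R * p'%:~R - q%:~R * q'%:~R * sd ^+ 2
    + (q%:~R * p'%:~R - p%:~R * q'%:~R) * sd); last by ring.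
  by rewrite sq /X /Y !mulrzBr !intrM.
have eY : X%:~R - Y%:~R * sd = (D%:R * y) * (p%:~R - q%:~R * sd).
  rewrite e' [RHS](_ : _ = p%:~R * p'%:~R - q%:~R * q'%:~R * sd ^+ 2
    - (q%:~R * p'%:~R - p%:~R * q'%:~R) * sd); last by ring.
  by rewrite sq /X /Y !mulrzBr !intrM.
have bX : `|X%:~R + Y%:~R * sd| <= W.
  apply: le_trans h1; rewrite eX !normrM normr_nat ler_wpM2l //; exact: mulr_ge0.
have bY : `|X%:~R - Y%:~R * sd| <= W.
  apply: le_trans h2; rewrite eY !normrM normr_nat ler_wpM2l //; exact: mulr_ge0.
have sd1 : 1 <= sd by rewrite -[leLHS]sqrtr1 ler_wsqrtr // ler1n.
exists X, Y, Z; split.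
  have D0 : D%:R != 0 :> R by rewrite pnatr_eq0 -lt0n.
  have c0 : p'%:~R - q'%:~R * sd != 0.
    have : Z%:~R != 0 :> R by rewrite intr_eq0.
    by rewrite eZ mulf_eq0 negb_or => /andP[].
  rewrite eX eZ; field.
  by rewrite c0 y0 D0.
rewrite !intr_norm; split.
- move: bX bY; rewrite !ler_norml => /andP[? ?] /andP[? ?]; apply/andP; lra.
- have : `|Y%:~R * sd| <= W.
    move: bX bY; rewrite !ler_norml => /andP[? ?] /andP[? ?]; apply/andP; lra.
  apply: le_trans; rewrite normrM ler_peMr // ger0_norm //; lra.
apply: le_trans h3; rewrite eZ !normrM normr_nat ler_wpM2l //; exact: mulr_ge0.
Qed.

End Lattice.

Lemma squarefree_nonsquare (d : nat) : (2 <= d)%N -> squarefree d ->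
  forall p q : int, p ^+ 2 = d%:Z * q ^+ 2 -> q = 0.
Proof.
move=> d2 sf p q e; apply/eqP; rewrite -absz_eq0 eqn0Ngt; apply/negP => q0.
have e' : (`|p| ^ 2 = d * `|q| ^ 2)%N.
  by have := congr1 absz e; rewrite abszM !abszX.
have : (`|q| %| `|p|)%N by rewrite -(@dvdn_pexp2r _ _ 2) // e' dvdn_mull.
move=> /dvdnP[k ek]; move: e'; rewrite ek expnMn => /eqP.
rewrite eqn_pmul2r ?expn_gt0 ?q0 // => /eqP kd.
have := sf k; rewrite kd dvdnn => /(_ isT) k1.
by move: kd d2; rewrite k1 => <-.
Qed.

Lemma quadratic_common_denominator (R : realType) (T : iet R) (d : nat) :
  defined_over T (quadratic_field R d) ->
  exists D : nat, exists B : R, [/\ (0 < D)%N, 0 <= B &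
    forall a, lat D d B (iet_len T a)].
Proof.
move=> h; have [a ha] := choice h; have [b hb] := choice ha.
pose D := (\prod_i `|denq (a i)| * \prod_i `|denq (b i)|)%N.
have D0 : (0 < D)%N.
  rewrite muln_gt0 !prodn_gt0 // => i; rewrite absz_gt0; exact: denq_neq0.
have clr (x : rat) : (`|denq x| %| D)%N -> exists m : int, D%:R * ratr x = m%:~R :> R.
  move=> /dvdnP[k ->]; exists (k%:Z * numq x).
  rewrite natrM rmorphM /= -pmulrn -mulrA; congr (_ * _).
  have -> : `|denq x|%:R = (denq x)%:~R :> R.
    by rewrite -[in RHS](gez0_abs (denq_ge0 x)) -pmulrn.
  by rewrite /ratr mulrCA mulfV ?mulr1 // intr_eq0 denq_neq0.
have pr (F : 'I_(iet_size T) -> nat) i : (F i %| \prod_j F j)%N.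
  by rewrite (bigD1 i) //= dvdn_mulr.
have [p hp] := choice (fun i => clr (a i) (dvdn_mulr _ (pr _ i))).
have [q hq] := choice (fun i => clr (b i) (dvdn_mull _ (pr _ i))).
clear clr; clearbody D.
pose F i : R := `|(p i)%:~R - (q i)%:~R * Num.sqrt d%:R|.
have F0 i : 0 <= F i by exact: normr_ge0.
exists D, (\sum_i F i); split => //; first exact: sumr_ge0.
move=> i; exists (p i), (q i); split; first by rewrite -hp -hq hb; ring.
by rewrite (bigD1 i) //= lerDl sumr_ge0.
Qed.


(** * Orbits and marks *)

Section Dynamics.
Variables (R : realType) (T : iet R).
Local Notation f := (iet_fun T).
Local Notation g := (iet_inv T).
Local Notation l := (iet_left T).
Local Notation r := (iet_right T).
Local Notation s := (iet_size T).
Local Notation gamma := (iet_gamma T).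
Implicit Types (x y z p q : R) (C : seq R) (n i k : nat).

Lemma iet_left_lt_right : l < r.
Proof.
rewrite /iet_right ltrDl.
have i0 : 'I_s := Ordinal (iet_size_gt0 T).
rewrite (bigD1 i0) //=; have := iet_len_gt0 T i0.
have : 0 <= \sum_(i | i != i0) iet_len T i by apply: sumr_ge0 => i _; exact/ltW/iet_len_gt0.
lra.
Qed.

Lemma iet_gamma0 (a : 'I_s) : a = 0%N :> nat -> gamma a = l.
Proof. by move=> a0; rewrite /iet_gamma big_pred0 ?addr0 // => b; rewrite a0. Qed.

Lemma iet_gammaS (a b : 'I_s) : b = a.+1 :> nat -> gamma b = iet_mu T a.
Proof. by move=> ba; rewrite /iet_gamma /iet_mu ba. Qed.

Lemma iet_mu_last (a : 'I_s) : a.+1 = s -> iet_mu T a = r.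
Proof.
move=> aE; rewrite /iet_mu /iet_right; congr (_ + _); apply: eq_bigl => b.
by have := ltn_ord b; rewrite -{2}aE ltnS => ->.
Qed.

Lemma iet_gamma_ge (a : 'I_s) : l <= gamma a.
Proof. by rewrite /iet_gamma lerDl sumr_ge0 // => b _; exact/ltW/iet_len_gt0. Qed.

Lemma iet_mu_le (a : 'I_s) : iet_mu T a <= r.
Proof. by rewrite lerD2l; apply: iet_sum_le => //; exact: iet_len_gt0. Qed.

Lemma iet_gamma_gt (a : 'I_s) : (0 < a)%N -> l < gamma a.
Proof.
move=> a0; rewrite /iet_gamma ltrDl (bigD1 (Ordinal (iet_size_gt0 T))) //=.
have := iet_len_gt0 T (Ordinal (iet_size_gt0 T)).
set S := \sum_(_ | _) _; have : 0 <= S by apply: sumr_ge0 => i _; exact/ltW/iet_len_gt0.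
lra.
Qed.

Lemma iet_gamma_dom (a : 'I_s) : l <= gamma a < r.
Proof.
rewrite iet_gamma_ge /=; apply: lt_le_trans (iet_mu_le a).
by rewrite iet_muE ltrDl iet_len_gt0.
Qed.

Lemma iet_letter_ex z : l <= z < r -> exists a : 'I_s, gamma a <= z < iet_mu T a.
Proof.
move=> zd; have := iet_letter_dom T z; rewrite in_itv /= zd.
case E: (iet_letter T z) => [a|//] _; exists a.
by move/iet_letterP: E; rewrite in_itv.
Qed.

Lemma iet_coletter_ex z : l <= z < r ->
  exists a : 'I_s, iet_nu T a - iet_len T a <= z < iet_nu T a.
Proof.
move=> zd; have := iet_coletter_dom T z; rewrite in_itv /= zd.
case E: (iet_coletter T z) => [a|//] _; exists a.
by move/iet_coletterP: E; rewrite in_itv.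
Qed.

Lemma iet_fun_on (a : 'I_s) z : gamma a <= z < iet_mu T a ->
  f z = z + (iet_nu T a - iet_mu T a).
Proof.
by move=> za; rewrite /iet_fun (_ : iet_letter T z = Some a) ?addrA //;
  apply/iet_letterP; rewrite in_itv.
Qed.

Lemma iet_inv_on (a : 'I_s) z : iet_nu T a - iet_len T a <= z < iet_nu T a ->
  g z = z - (iet_nu T a - iet_mu T a).
Proof.
move=> za; rewrite /iet_inv (_ : iet_coletter T z = Some a); last first.
  by apply/iet_coletterP; rewrite in_itv.
lra.
Qed.

Lemma iet_fun_gamma (a : 'I_s) : f (gamma a) = iet_nu T a - iet_len T a.
Proof.
rewrite (@iet_fun_on a); first by rewrite iet_muE; lra.
by rewrite lexx iet_muE ltrDl iet_len_gt0.
Qed.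

Lemma iet_fun_dom z : (l <= f z < r) = (l <= z < r).
Proof.
have := iet_letter_dom T z; rewrite in_itv /= => <-; rewrite /iet_fun.
case E: (iet_letter T z) => [a|/=]; last first.
  by have := iet_letter_dom T z; rewrite in_itv /= E.
move/iet_letterP: E; rewrite in_itv /= iet_muE => za.
rewrite (_ : (_ <= _ < _) = iet_coletter T (z + iet_nu T a - (gamma a + iet_len T a))).
  rewrite (_ : iet_coletter _ _ = Some a) //.
  by apply/iet_coletterP; rewrite in_itv /=; lra.
by have := iet_coletter_dom T (z + iet_nu T a - (gamma a + iet_len T a)); rewrite in_itv.
Qed.

Lemma iter_fun_dom n z : (l <= iter n f z < r) = (l <= z < r).
Proof. by elim: n => //= n IH; rewrite iet_fun_dom. Qed.

Lemma iter_funK n : cancel (iter n f) (iter n g).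
Proof. by elim: n => // n IH z; rewrite iterSr iterS iet_funK. Qed.

Lemma iter_invK n : cancel (iter n g) (iter n f).
Proof. by elim: n => // n IH z; rewrite iterSr iterS iet_invK. Qed.

Lemma iter_inv_dom n z : (l <= iter n g z < r) = (l <= z < r).
Proof. by rewrite -(iter_fun_dom n) iter_invK. Qed.

(* The points that reach a point of C within n steps, or a separation point of
   T within n - 1 steps: T, ..., T^n are translations between two neighbouring
   marks, and the iterates there stay on the same side of each point of C. *)
Definition marks n C : seq R :=
  [seq iter i g c | i <- iota 0 n, c <- [seq gamma a | a : 'I_s <- enum 'I_s & (0 < a)%N]]
  ++ [seq iter i g c | i <- iota 0 n.+1, c <- C].

Lemma marksP n C z : z \in marks n C <->
  (exists i (j : 'I_s), [/\ (i < n)%N, (0 < j)%N & iter i f z = gamma j]) \/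
  (exists i c, [/\ (i <= n)%N, c \in C & iter i f z = c]).
Proof.
rewrite mem_cat; split.
  case/orP=> /allpairsP[[i c]] /= [ii cc ->]; move: ii cc.
    rewrite mem_iota.
    move=> i_n /mapP[j]; rewrite mem_filter => /andP[j0 _] ->.
    by left; exists i, j; rewrite iter_invK.
  rewrite -[0%N :: _]/(iota 0 n.+1) mem_iota.
  by move=> i_n cC; right; exists i, c; rewrite iter_invK.
case=> [[i [j [i_n j0 e]]]|[i [c [i_n cC e]]]]; apply/orP; [left|right].
  apply/allpairsP; exists (i, gamma j) => /=; rewrite mem_iota -e iter_funK; split => //.
  by rewrite e map_f // mem_filter j0 mem_enum.
apply/allpairsP; exists (i, c); split => //; first by rewrite mem_iota.
by rewrite /= -e iter_funK.
Qed.

(** The left end may itself be a mark, because the intervals exchanged by [T] contain their left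
    ends. *)
Definition unmarked n C x y : Prop := forall e, e \in marks n C -> ~ (x < e < y).

Lemma cell n C z : l <= z < r ->
  exists p q, [/\ l <= p <= z, z < q <= r, p \in l :: marks n C,
    q \in r :: marks n C & unmarked n C p q].
Proof. exact: cell_exists. Qed.

Section Unmarked.
Variables (n : nat) (C : seq R) (x y : R).
Hypotheses (lx : l <= x) (yr : y <= r) (xy_free : unmarked n C x y).

(** Induction step of [unmarked_iter], which supplies the last hypothesis. If T^i z lay beyond the
    interval of T^i x, the separation point ending that interval would pull back to a mark strictly
    between [x] and [y]. *)
Lemma unmarked_letter i z : (i < n)%N -> x <= z < y ->
  (forall z', x <= z' < y -> iter i f z' = z' + (iter i f x - x)) ->
  exists2 a : 'I_s, gamma a <= iter i f x < iet_mu T a &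
    gamma a <= iter i f z < iet_mu T a.
Proof.
move=> i_n xzy tr.
have lx' := lx; have yr' := yr.
have xd : l <= iter i f x < r by rewrite iter_fun_dom; lra.
have zd : l <= iter i f z < r by rewrite iter_fun_dom; lra.
have [a xa] := iet_letter_ex xd; exists a => //.
rewrite ltNge; apply/andP; split; first by move: xa; rewrite (tr z) //; lra.
apply/negP => az.
have [sa|sa] := eqVneq a.+1 s; first by move: az zd; rewrite (iet_mu_last sa); lra.
have bs : (a.+1 < s)%N by rewrite ltn_neqAle sa ltn_ord.
have gb : gamma (Ordinal bs) = iet_mu T a by exact: iet_gammaS.
rewrite (tr z) // in az.
have ee : x <= iet_mu T a - (iter i f x - x) < y by lra.
apply: (@xy_free (iet_mu T a - (iter i f x - x))); last by lra.
by apply/marksP; left; exists i, (Ordinal bs); rewrite gb tr ?subrK.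
Qed.

Lemma unmarked_iter i z : (i <= n)%N -> x <= z < y ->
  iter i f z = z + (iter i f x - x).
Proof.
elim: i z => [|i IH] z i_n xzy /=; first by rewrite subrr addr0.
have [a xa za] := unmarked_letter i_n xzy (fun z' => IH z' (ltnW i_n)).
by rewrite (iet_fun_on xa) (iet_fun_on za) (IH z (ltnW i_n) xzy); lra.
Qed.

Lemma unmarked_iter2 i z z' : (i <= n)%N -> x <= z < y -> x <= z' < y ->
  iter i f z - z = iter i f z' - z'.
Proof. by move=> i_n zd zd'; rewrite (unmarked_iter i_n zd) (unmarked_iter i_n zd'); ring. Qed.

Lemma unmarked_same_letter i z z' : (i < n)%N -> x <= z < y -> x <= z' < y ->
  iet_letter T (iter i f z) = iet_letter T (iter i f z').
Proof.
move=> i_n.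
suff H w : x <= w < y -> iet_letter T (iter i f w) = iet_letter T (iter i f x).
  by move=> /H -> /H ->.
move=> wd; have [a xa wa] := unmarked_letter i_n wd (fun z' => @unmarked_iter i z' (ltnW i_n)).
have -> : iet_letter T (iter i f w) = Some a by apply/iet_letterP; rewrite in_itv.
by symmetry; apply/iet_letterP; rewrite in_itv.
Qed.

Lemma unmarked_side i c z z' : (i <= n)%N -> c \in C -> x <= z < y -> x <= z' < y ->
  (c <= iter i f z) = (c <= iter i f z').
Proof.
move=> i_n cC.
suff H w : x <= w < y -> (c <= iter i f w) = (c <= iter i f x).
  by move=> /H -> /H ->.
move=> wd; apply/idP/idP; rewrite (unmarked_iter i_n wd); last by lra.
move=> cw; rewrite leNgt; apply/negP => xc.
have ee : x <= c - (iter i f x - x) < y by lra.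
apply: (@xy_free (c - (iter i f x - x))); last by lra.
by apply/marksP; right; exists i, c; rewrite (unmarked_iter i_n) ?subrK.
Qed.

End Unmarked.

Lemma periodic_iet_orbit_finite z n : (0 < n)%N -> iter n f z = z ->
  finite_set (iet_orbit T z).
Proof.
move=> n0 per.
have perM m : iter (m * n) f z = z.
  by elim: m => // m IH; rewrite mulSn iterD IH per.
have red m : iter m f z = iter (m %% n) f z.
  by rewrite {1}(divn_eq m n) addnC iterD perM.
apply: (@sub_finite_set _ _ ((fun i => iter i f z) @` `I_n)%classic); last first.
  exact/finite_image/finite_II.
move=> _ [k _ <-]; case: k => m /=.
  by exists (m %% n)%N; [rewrite /= ltn_mod|rewrite -red].
exists ((m.+1 * n - m.+1) %% n)%N; first by rewrite /= ltn_mod.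
rewrite -red -[in RHS](perM m.+1).
by rewrite -{2}(subnKC (leq_pmulr m.+1 n0)) iterD -iterS iter_funK.
Qed.

Hypothesis T_regular : iet_regular T.

(** A connection of positive length would make the orbit of [gamma i] finite if [i = j], and would
    make two orbits meet otherwise. *)
Lemma regular_connection n (i j : 'I_s) : (0 < i)%N -> (0 < j)%N ->
  iter n f (gamma i) = gamma j -> n = 0%N.
Proof.
move=> i0 j0 e; case: n e => // n e; exfalso.
have [ij|ij] := eqVneq i j.
  case: T_regular => /(_ i i0) + _; apply.
  by apply: (@periodic_iet_orbit_finite _ n.+1) => //; rewrite e ij.
case: T_regular => _ /(_ i j i0 j0 ij) e0.
suff : (set0 : set R) (gamma j) by [].
by rewrite -e0; split; [exists n.+1%:Z|exists 0].
Qed.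

Hypothesis s_gt1 : (1 < s)%N.

(** The witness is the letter [o i0] whose image comes first. If it is the first letter, the image
    of [o i1] starts at [gamma i1], a connection of length 1. *)
Lemma regular_left_preimage : exists2 c : 'I_s, (0 < c)%N & f (gamma c) = l.
Proof.
pose o := iet_perm T.
pose i0 : 'I_s := Ordinal (iet_size_gt0 T); pose i1 : 'I_s := Ordinal s_gt1.
have fl : f (gamma (o i0)) = l.
  rewrite iet_fun_gamma /iet_nu iet_sum_split addrA addrK permK.
  by rewrite big_pred0 ?addr0.
have [c0|] := posnP (o i0); last by exists (o i0).
have oi0 : o i0 = i0 by exact: val_inj.
have oi1 : (0 < o i1)%N.
  rewrite lt0n; apply/eqP => oi1.
  have /perm_inj : o i1 = o i0 by apply: val_inj; rewrite /= oi1 c0.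
  by move/(congr1 val).
have f1 : f (gamma (o i1)) = gamma i1.
  rewrite iet_fun_gamma /iet_nu iet_sum_split addrA addrK permK /iet_gamma.
  congr (_ + _); rewrite (big_pred1 i0); last first.
    move=> b /=; rewrite ltnS leqn0 -[RHS](inj_eq (@perm_inj _ o^-1)).
    by rewrite -[in RHS]oi0 permK -(inj_eq val_inj).
  rewrite (big_pred1 i0) // => b; rewrite /= ltnS leqn0.
  by rewrite -(inj_eq val_inj).
by have := @regular_connection 1 _ _ oi1 (isT : (0 < i1)%N) f1.
Qed.

(** If T^k fixes [z], it is the identity on the cell of [z], in particular at its left end [p]. As
    [p] is [l], the image of a separation point, or reaches one within [k - 1] steps, some
    separation point is periodic. *)
Lemma regular_aperiodic z k : (0 < k)%N -> l <= z < r -> iter k f z != z.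
Proof.
move=> k0 zd; apply/eqP => per.
have [p [q [pz zq pm _ pq]]] := cell k [::] zd.
have lp : l <= p by lra.
have qr : q <= r by lra.
have := unmarked_iter2 lp qr pq (leqnn k) (z := z) (z' := p).
rewrite per subrr => /(_ ltac:(lra) ltac:(lra)) perp.
have {}perp : iter k f p = p by lra.
have iter_comm m n w : iter m f (iter n f w) = iter n f (iter m f w).
  by rewrite -!iterD addnC.
move: pm; rewrite inE => /orP[/eqP pl|/marksP[]].
- have [c c0 fc] := regular_left_preimage.
  have : iter k f (gamma c) = gamma c.
    apply: (can_inj (@iet_funK _ T)); rewrite -iterS iterSr fc.
    by rewrite -pl perp.
  by move/(regular_connection c0 c0) => k00; rewrite k00 in k0.
- move=> [i [j [ik j0 e]]].
  have : iter k f (gamma j) = gamma j by rewrite -e iter_comm perp.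
  by move/(regular_connection j0 j0) => k00; rewrite k00 in k0.
by move=> [i [c [_ ]]]; rewrite in_nil.
Qed.

End Dynamics.

(** * Gaps between the preimages of separation points *)

Section Gaps.
Variables (R : realType) (T : iet R).
Local Notation f := (iet_fun T).
Local Notation g := (iet_inv T).
Local Notation l := (iet_left T).
Local Notation r := (iet_right T).
Local Notation s := (iet_size T).
Local Notation gamma := (iet_gamma T).
Implicit Types (x y z p q B : R) (C : seq R) (n i k : nat).

Lemma marks_le n n' C : (n <= n')%N -> {subset marks T n C <= marks T n' C}.
Proof.
move=> nn' e /marksP H; apply/marksP; case: H => [[i [j [i_n j0 h]]]|[i [c [i_n cC h]]]].
  by left; exists i, j; split => //; exact: leq_trans nn'.
by right; exists i, c; split => //; exact: leq_trans nn'.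
Qed.

Lemma unmarked_range n C x y i : l <= x -> x < y -> y <= r -> unmarked T n C x y ->
  (i <= n)%N -> l <= iter i f x /\ iter i f x + (y - x) <= r.
Proof.
move=> lx xy yr xyf i_n.
have xd : l <= iter i f x < r by rewrite iter_fun_dom; lra.
split; first by case/andP: xd.
rewrite leNgt; apply/negP => h.
have zd : x <= r - (iter i f x - x) < y by lra.
have := iter_fun_dom T i (r - (iter i f x - x)).
rewrite (unmarked_iter lx yr xyf i_n zd); lra.
Qed.

(** Pigeonhole: the translates T^i [x, x + w[ for [i <= m] have total length above [r - l], so those
    of two times [i < j] meet, and T^(j - i) moves a point, hence also [x], by less than [w]. *)
Lemma close_return n C x y (w : R) m : l <= x -> y <= r -> unmarked T n C x y ->
  0 < w <= y - x -> (m <= n)%N -> r - l < m.+1%:R * w ->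
  exists k, (0 < k <= m)%N /\ `|iter k f x - x| < w.
Proof.
move=> lx yr xyf wxy mn; apply: contraPP => nex; apply/negP; rewrite -leNgt.
have xy : x < y by lra.
have lr : l <= r by exact/ltW/iet_left_lt_right.
have -> : m.+1%:R * w = \sum_(i in [set: 'I_m.+1]) w.
  by rewrite big_const cardsT card_ord iter_addr_0 mulr_natl.
apply: (@disjoint_itv_sum R _ _ (fun i : 'I_m.+1 => iter i f x) (fun=> w)) => // [i _|i _|i j _ _ ij z].
- lra.
- have i_n : (i <= n)%N by apply: leq_trans mn; rewrite -ltnS.
  have [] := unmarked_range lx xy yr xyf i_n; lra.
wlog ij' : i j ij / (i < j)%N.
  move=> H [h1 h2]; have := ij; rewrite -(inj_eq val_inj) /= neq_ltn => /orP[] ltij.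
    exact: (H i j).
  by apply: (H j i) => //; rewrite eq_sym.
move=> [zi zj].
have i_n : (i <= n)%N by apply: leq_trans mn; rewrite -ltnS.
have j_n : (j <= n)%N by apply: leq_trans mn; rewrite -ltnS.
pose u1 := z - (iter i f x - x); pose u2 := z - (iter j f x - x).
have d1 : x <= u1 < y by rewrite /u1; lra.
have d2 : x <= u2 < y by rewrite /u2; lra.
have e1 : iter i f u1 = z by rewrite (unmarked_iter lx yr xyf i_n d1) /u1; lra.
have e2 : iter j f u2 = z by rewrite (unmarked_iter lx yr xyf j_n d2) /u2; lra.
have e12 : iter (j - i) f u2 = u1.
  by apply: (can_inj (@iter_funK R T i)); rewrite -iterD subnKC ?e1 // ltnW.
apply: nex; exists (j - i)%N; split.
  by rewrite subn_gt0 ij' /= (leq_trans (leq_subr _ _)) // -ltnS.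
have := unmarked_iter lx yr xyf (leq_trans (leq_subr i j) j_n) d2.
rewrite e12 => e.
have -> : iter (j - i) f x - x = u1 - u2 by lra.
rewrite ltr_norml /u1 /u2; lra.
Qed.

(* T^k translates [p, q[ by dl and the ends of [p, q[ are preimages of separation
   points (or l, r): [p, q[ is the cross-section of a cylinder of height k. *)
Section Cylinder.
Variables (k : nat) (p q dl : R).
Hypotheses (lp : l <= p) (pq : p < q) (qr : q <= r).
Hypotheses (p_end : p \in l :: marks T k [::]) (q_end : q \in r :: marks T k [::]).
Hypothesis pq_free : unmarked T k [::] p q.
Hypothesis dlP : forall z, p <= z < q -> iter k f z = z + dl.

Lemma cylinder_left : p = l \/ exists i (j : 'I_s),
  [/\ (i < k)%N, (0 < j)%N & iter i f p = gamma j].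
Proof.
by move: p_end; rewrite inE => /orP[/eqP|/marksP[|[? [? []]]//]]; [left|right].
Qed.

Lemma cylinder_right : q = r \/ exists i (j : 'I_s),
  [/\ (i < k)%N, (0 < j)%N & iter i f q = gamma j].
Proof.
by move: q_end; rewrite inE => /orP[/eqP|/marksP[|[? [? []]]//]]; [left|right].
Qed.

Lemma cylinder_unmarked z i (j : 'I_s) : p < z < q -> (i < k)%N -> (0 < j)%N ->
  iter i f z <> gamma j.
Proof.
move=> zd i_k j0 e; apply: (pq_free _ zd).
by apply/marksP; left; exists i, j.
Qed.

(** If [i + i' >= k], the separation point would be reached from T^k z = z + dl in [i + i' - k < k]
    further steps. *)
Lemma cylinder_unmarked2 z i i' (j : 'I_s) : p < z < q -> p < z + dl < q ->
  (i < k)%N -> (i' < k)%N -> (0 < j)%N -> iter i f (iter i' f z) <> gamma j.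
Proof.
move=> zd zd' i_k i_k' j0; rewrite -iterD.
have [ii|ii] := ltnP (i + i') k; first exact: cylinder_unmarked.
rewrite -(subnK ii) iterD dlP; last by lra.
apply: cylinder_unmarked => //.
by rewrite ltn_subLR // -addnS leq_add // ltnW.
Qed.

(* If T^i [p, q[ met [p, q[ too closely, an end of [p, q[ would be T^i z for some z
   with both z and T^k z inside [p, q[, and z would reach a separation point
   while T^k is continuous there. *)
Lemma cylinder_disjoint i z0 : (i < k)%N -> p <= z0 < q ->
  `|dl| < `|iter i f z0 - z0| -> (q - p) - `|dl| <= `|iter i f p - p|.
Proof.
move=> ik z0d tx; rewrite leNgt; apply/negP => h.
have ik' := ltnW ik.
have [lp' [pq' qr']] := (lp, (pq, qr)).
have tE z : p <= z < q -> iter i f z - z = iter i f p - p.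
  by move=> zd; apply: (unmarked_iter2 lp qr pq_free ik' zd); lra.
rewrite (tE z0 z0d) in tx.
have [r1 r2] := unmarked_range lp pq qr pq_free ik'.
have nlt := ler_norm dl; have nlt' : - dl <= `|dl| by rewrite -normrN ler_norm.
have [t0|t0] := lerP 0 (iter i f p - p).
  rewrite ger0_norm // in h tx.
  have [qE|[i' [j [ik2 j0 e]]]] := cylinder_right; first by lra.
  (* Since [|dl| < T^i p - p < (q - p) - |dl|], both [z] and [z + dl] are interior, while T^i z =
     q. *)
  pose z := q - (iter i f p - p).
  have zd : p <= z < q by rewrite /z; lra.
  have zq : iter i f z = q by have := tE z zd; rewrite /z; lra.
  have zd1 : p < z < q by rewrite /z; lra.
  have zd2 : p < z + dl < q by rewrite /z; lra.
  by apply: (cylinder_unmarked2 zd1 zd2 ik2 ik j0); rewrite zq.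
rewrite ltr0_norm // in h tx.
have [pE|[i' [j [ik2 j0 e]]]] := cylinder_left; first by lra.
pose z := p - (iter i f p - p).
have zd : p <= z < q by rewrite /z; lra.
have zq : iter i f z = p by have := tE z zd; rewrite /z; lra.
have zd1 : p < z < q by rewrite /z; lra.
have zd2 : p < z + dl < q by rewrite /z; lra.
by apply: (cylinder_unmarked2 zd1 zd2 ik2 ik j0); rewrite zq.
Qed.

(** Successive translates of ]x, y[ by [dl] overlap, so the first one to leave [p, q[ contains [p]
    or [q]. That end is an end of the domain, or reaches a separation point in fewer than [k] steps,
    which pulls back to a mark in ]x, y[. *)
Lemma cylinder_drift n x y j : p <= x -> x < y -> y <= q -> `|dl| < y - x ->
  unmarked T n [::] x y -> (j.+1 * k <= n)%N ->
  iter (j * k) f x = x + j%:R * dl /\ (p <= x + j%:R * dl /\ y + j%:R * dl <= q).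
Proof.
move=> px xy yq dlt xyf.
have [lp' [pq' qr']] := (lp, (pq, qr)).
have nlt := ler_norm dl; have nlt' : - dl <= `|dl| by rewrite -normrN ler_norm.
have lx : l <= x by lra.
have yr : y <= r by lra.
elim: j => [|j IH] jn; first by rewrite !mul0r !addr0; split => //; lra.
have jn' : (j.+1 * k <= n)%N by apply: leq_trans jn; rewrite leq_mul2r leqnSn orbT.
have [e [h1 h2]] := IH jn'.
have jE : j.+1%:R * dl = j%:R * dl + dl by rewrite -natr1; ring.
have e' : iter (j.+1 * k) f x = x + j.+1%:R * dl.
  rewrite mulSn iterD e dlP; first by rewrite jE; ring.
  lra.
split => //.
have [r1 r2] := unmarked_range lx xy yr xyf jn'; rewrite e' in r1 r2.
have key z i' (jj : 'I_s) : x < z < y -> (i' < k)%N -> (0 < jj)%N ->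
    iter i' f (z + j.+1%:R * dl) <> gamma jj.
  move=> zd ik j0.
  have -> : z + j.+1%:R * dl = iter (j.+1 * k) f z.
    rewrite (unmarked_iter lx yr xyf jn'); first by rewrite e'; ring.
    lra.
  move=> ee; apply: (xyf z _ zd).
  apply/marksP; left; exists (i' + j.+1 * k)%N, jj; split => //; last by rewrite iterD.
  by apply: leq_trans jn; rewrite [leqRHS]mulSn ltn_add2r.
rewrite jE in r1 r2 *; rewrite jE in key.
split; rewrite leNgt; apply/negP => hh.
  have [pE|[i' [jj [ik2 j0 ee]]]] := cylinder_left; first by lra.
  apply: (key (p - (j%:R * dl + dl)) i' jj _ ik2 j0); last by rewrite subrK.
  lra.
have [qE|[i' [jj [ik2 j0 ee]]]] := cylinder_right; first by lra.
apply: (key (q - (j%:R * dl + dl)) i' jj _ ik2 j0); last by rewrite subrK.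
lra.
Qed.

End Cylinder.

Hypothesis T_regular : iet_regular T.
Hypothesis s_gt1 : (1 < s)%N.
Variables (D d : nat) (kappa : R).
Hypothesis D_gt0 : (0 < D)%N.
Hypothesis d_nonsquare : forall p q : int, p ^+ 2 = d%:Z * q ^+ 2 -> q = 0.
Hypothesis kappa_gt0 : 0 < kappa.
Local Notation lat := (@lat R D d).
Hypothesis lat_iter : forall n z, lat (n%:R * kappa) (iter n f z - z).
Hypothesis lat_gamma : forall a, lat kappa (gamma a - l).
Hypothesis lat_right : lat kappa (r - l).

Lemma lat_marks n C B e : 0 <= B -> (forall c, c \in C -> lat B (c - l)) ->
  e \in marks T n C -> lat (n.+1%:R * kappa + B) (e - l).
Proof.
move=> B0 hC /marksP H; have k0 := kappa_gt0.
have kn i : (i <= n)%N -> i%:R * kappa <= n%:R * kappa.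
  by move=> i_n; rewrite ler_pM2r // ler_nat.
rewrite -natr1 mulrDl mul1r.
case: H => [[i [j [i_n j0 h]]]|[i [c [i_n cC h]]]].
  have -> : e - l = (gamma j - l) - (iter i f e - e) by rewrite h; ring.
  apply: lat_le (latB (lat_gamma j) (lat_iter i e)).
  have := kn _ (ltnW i_n); lra.
have -> : e - l = (c - l) - (iter i f e - e) by rewrite h; ring.
apply: lat_le (latB (hC _ cC) (lat_iter i e)).
have := kn _ i_n; lra.
Qed.

Lemma lat_cell n C B p q : 0 <= B -> (forall c, c \in C -> lat B (c - l)) ->
  p \in l :: marks T n C -> q \in r :: marks T n C ->
  lat (2 * (n.+1%:R * kappa + B)) (q - p).
Proof.
move=> B0 hC pm qm; have k0 := kappa_gt0.
have n1 : kappa <= n.+1%:R * kappa by rewrite ler_peMl ?ler1n // ltW.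
have -> : q - p = (q - l) - (p - l) by ring.
rewrite mulr_natl mulr2n; apply: latB.
  move: qm; rewrite inE => /orP[/eqP->|]; last exact: lat_marks.
  by apply: lat_le lat_right; lra.
move: pm; rewrite inE => /orP[/eqP->|]; last exact: lat_marks.
by rewrite subrr; apply: lat_le (lat0 _ _ _); lra.
Qed.

(** Let [k] be the first time at which T^k moves [x] by less than [ep = y - x]. Then [k ep <= L],
    and the number of turns made in the cylinder over the cell of [x] of order [k] remains to be
    bounded. *)
Lemma gap_bound : exists2 Cg : R, 0 < Cg & forall n x y,
  l <= x -> x < y -> y <= r -> unmarked T n [::] x y -> n%:R * (y - x) <= Cg.
Proof.
pose L := r - l; have L0 : 0 < L by rewrite subr_gt0 iet_left_lt_right.
(* Chosen so that [J0] turns contradict the estimates [width] and [dl1] below. *)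
pose J0 := (Num.bound (D%:R * kappa * L)).+1.
have J0P : D%:R * kappa * L < J0%:R - 1.
  rewrite /J0 -natr1 addrK; apply: archi_boundP.
  by rewrite !mulr_ge0 // ltW.
exists (J0.+1%:R * L); first by rewrite mulr_gt0.
move=> n x y lx xy yr xyf.
pose ep := y - x; have ep0 : 0 < ep by rewrite subr_gt0.
have J1 : 1 <= J0.+1%:R :> R by rewrite ler1n.
have [nep|nep] := lerP (n%:R * ep) L.
  by apply: (le_trans nep); rewrite ler_peMl // ltW.
have [m /andP[mL Lm]] : exists m, m%:R * ep <= L < m.+1%:R * ep.
  exists (Num.truncn (L / ep)); have := truncn_itv (ltW (divr_gt0 L0 ep0)).
  by rewrite ler_pdivlMr // ltr_pdivrMr.
have mn : (m <= n)%N by rewrite -(@ler_nat R) -(@ler_pM2r _ ep) //; lra.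
have exk : exists k, (0 < k <= m)%N && (`|iter k f x - x| < ep).
  have [||k [k0 h]] := @close_return n [::] x y ep m lx yr xyf _ mn => //.
    by rewrite ep0 lexx.
  by exists k; rewrite k0.
case: (ex_minnP exk) => k /andP[/andP[k0 km] dlt] kmin.
have kn : (k <= n)%N by exact: leq_trans mn.
have kL : k%:R * ep <= L.
  by apply: le_trans mL; rewrite ler_pM2r // ler_nat.
pose dl := iter k f x - x.
have xd : l <= x < r by lra.
have [p [q [px xq pm qm pq]]] := cell k [::] xd.
have lp : l <= p by lra.
have qr : q <= r by lra.
have dl0 : dl != 0 by rewrite subr_eq0 regular_aperiodic //; lra.
have dl1 : 1 <= D%:R * kappa * (k%:R * `|dl|).
  have := lat_lower D_gt0 d_nonsquare (lat_iter k x) dl0.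
  by rewrite -/dl => h; apply: (le_trans h); rewrite le_eqVlt; apply/orP; left; apply/eqP; ring.
have yq : y <= q.
  move: qm; rewrite inE => /orP[/eqP->//|qm]; rewrite leNgt; apply/negP => qy.
  by apply: (xyf q); [exact: marks_le qm|lra].
have pq' : p < q by lra.
have px' : p <= x by lra.
have xd' : p <= x < q by lra.
have dlP z : p <= z < q -> iter k f z = z + dl.
  move=> zd.
  have := unmarked_iter2 lp qr pq (leqnn k) zd xd'; rewrite -/dl; lra.
(* A greater width would give [i < k] with T^i p close to [p]. This contradicts [cylinder_disjoint],
   which applies because T^i moves [x] by at least [ep > |dl|], [k] being minimal. *)
have width : k%:R * ((q - p) - `|dl|) <= L.
  rewrite leNgt; apply/negP => h.
  have [|||i [/andP[i0 ik] hi]] := @close_return k [::] p q ((q - p) - `|dl|) k.-1 lp qr pq.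
  - have dlt' : `|dl| < y - x := dlt.
    have := normr_ge0 dl; lra.
  - exact: leq_pred.
  - by rewrite prednK.
  have ik2 : (i < k)%N by rewrite -(prednK k0) ltnS.
  have := cylinder_disjoint lp pq' qr pm qm pq dlP ik2 xd'.
  rewrite leNgt hi => /(_ _)/negP; apply => //.
  apply: (lt_le_trans dlt); rewrite leNgt; apply/negP => ix.
  have := kmin i; rewrite i0 ix (leq_trans (ltnW ik2)) // => /(_ isT).
  by rewrite leqNgt ik2.
(* Otherwise [J0 |dl| <= q - p] by drift, so [k (J0 - 1) |dl| <= L] by [width], and [dl1] yields
   [J0 - 1 <= D kappa L]. *)
have nJ : (n < J0.+1 * k)%N.
  rewrite ltnNge; apply/negP => Jn.
  have [_ [h1 h2]] := cylinder_drift lp pq' qr pm qm dlP px' xy yq dlt xyf Jn.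
  have jd : J0%:R * `|dl| <= q - p.
    have -> : J0%:R * `|dl| = `|J0%:R * dl| by rewrite normrM normr_nat.
    by rewrite ler_norml; apply/andP; lra.
  have k1 : 0 <= k%:R :> R by exact: ler0n.
  have : k%:R * (J0%:R * `|dl| - `|dl|) <= L.
    by apply: le_trans width; rewrite ler_wpM2l // lerD2r.
  have J10 : 0 <= J0%:R - 1 :> R by rewrite subr_ge0 ler1n.
  have Dk : 0 < D%:R * kappa by rewrite mulr_gt0 // ltr0n.
  rewrite -(ler_pM2l Dk) => hL.
  have : (J0%:R - 1) * 1 <= (J0%:R - 1) * (D%:R * kappa * (k%:R * `|dl|)).
    by rewrite ler_wpM2l.
  have -> : (J0%:R - 1) * (D%:R * kappa * (k%:R * `|dl|)) =
    D%:R * kappa * (k%:R * (J0%:R * `|dl| - `|dl|)) by ring.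
  move: hL J0P; lra.
apply: (@le_trans _ _ ((J0.+1 * k)%:R * ep)).
  by rewrite ler_pM2r // ler_nat ltnW.
by rewrite natrM -mulrA ler_wpM2l.
Qed.



(** The levels [P i] are disjoint, so the lengths of the intervals they contain, which dominate a
    harmonic sum, add up to at most [r - l]. The constant is that of [hitting_cell]; [M] is chosen
    before [N], which will grow as the target shrinks. *)
Lemma harmonic_levels : exists M : nat, forall (N m : nat) (P : nat -> R -> Prop),
  (0 < N)%N ->
  (forall i j w, (i < j)%N -> P i w -> P j w -> False) ->
  (forall i, (i < m)%N -> exists a b, [/\ l <= a, b <= r,
     (2 * D%:R * kappa)^-1 / (i + N)%:R <= b - a & forall w, a <= w < b -> P i w]) ->
  (m <= M * N)%N.
Proof.
have c0 : 0 < (2 * D%:R * kappa)^-1.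
  by rewrite invr_gt0 -mulrA !mulr_gt0 // ltr0n.
have [M MP] := harmonic_bound (r - l) c0.
exists M => N m P N0 Pdisj Pex; apply: MP => //.
have {}Pex (i : 'I_m) := Pex i (ltn_ord i).
have [a ha] := choice Pex; have [b hb] := choice ha.
have pos (i : 'I_m) : 0 < (2 * D%:R * kappa)^-1 / (i + N)%:R.
  by rewrite divr_gt0 // ltr0n addn_gt0 N0 orbT.
apply: (@le_trans _ _ (\sum_(i in [set: 'I_m]) (b i - a i))).
  rewrite [leRHS](eq_bigl xpredT) => [|i]; last by rewrite finset.in_setT.
  by apply: ler_sum => i _; have [] := hb i.
apply: (@disjoint_itv_sum R _ _ a) => [|i _|i _|i j _ _ ij z].
- exact/ltW/iet_left_lt_right.
- by apply: lt_le_trans (pos i) _; have [] := hb i.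
- by have [? ? _ _] := hb i; rewrite addrC subrK.
rewrite ![a _ + _]addrC !subrK => -[zi zj].
have Pi : P i z by have [_ _ _] := hb i; apply.
have Pj : P j z by have [_ _ _] := hb j; apply.
have := ij; rewrite -(inj_eq val_inj) /= neq_ltn => /orP[] lt_ij.
  exact: Pdisj lt_ij Pi Pj.
exact: Pdisj lt_ij Pj Pi.
Qed.

(** * Hitting times *)

Section Hitting.
Variables (u v B : R).
Hypotheses (lu : l <= u) (uv : u < v) (vr : v <= r).
Hypotheses (B_ge0 : 0 <= B) (lat_u : lat B (u - l)) (lat_v : lat B (v - l)).
Let C := [:: u; v].

Lemma hitting_side n p q i z z' : l <= p -> q <= r -> unmarked T n C p q ->
  (i <= n)%N -> p <= z < q -> p <= z' < q ->
  (u <= iter i f z < v) = (u <= iter i f z' < v).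
Proof.
move=> lp qr pq i_n zd zd'; congr (_ && _).
  by apply: (unmarked_side lp qr pq i_n _ zd zd'); rewrite mem_head.
by rewrite !ltNge (unmarked_side lp qr pq i_n _ zd zd') // !inE eqxx orbT.
Qed.

(** As [B <= N kappa], both ends of the cell have conjugates at most [(n + N.+1) kappa], and
    [lat_lower] keeps them apart. *)
Lemma hitting_cell n (N : nat) z : (0 < N)%N -> B <= N%:R * kappa -> l <= z < r ->
  exists p q, [/\ l <= p <= z, z < q <= r, p \in l :: marks T n C, unmarked T n C p q &
    (2 * D%:R * kappa)^-1 / (n + N.+1)%:R <= q - p].
Proof.
move=> N0 BN zd; have [p [q [pz qz pm qm pq]]] := cell n C zd; exists p, q; split => //.
have hC c : c \in C -> lat B (c - l) by rewrite !inE => /orP[]/eqP->.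
have qp : 0 < q - p by move: pz qz => ? ?; lra.
have := lat_lower D_gt0 d_nonsquare (lat_cell B_ge0 hC pm qm) (lt0r_neq0 qp).
rewrite (gtr0_norm qp) => h.
have Dk : 0 < D%:R * kappa by rewrite mulr_gt0 // ltr0n.
have nN : 0 < (n + N.+1)%:R :> R by rewrite ltr0n addnS.
rewrite -invfM -[leLHS]mul1r ler_pdivrMr; last first.
  by rewrite -[2 * _ * _]mulrA; do 2! apply: mulr_gt0 => //.
apply: (le_trans h); rewrite mulrC ler_pM2l //.
rewrite addnS -addSn natrD.
have : D%:R * B <= D%:R * (N%:R * kappa) by rewrite ler_wpM2l.
lra.
Qed.

Variables (N M : nat).
Hypotheses (N_gt0 : (0 < N)%N) (BN : B <= N%:R * kappa).
Hypothesis MP : forall (N m : nat) (P : nat -> R -> Prop), (0 < N)%N ->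
  (forall i j w, (i < j)%N -> P i w -> P j w -> False) ->
  (forall i, (i < m)%N -> exists a b, [/\ l <= a, b <= r,
     (2 * D%:R * kappa)^-1 / (i + N)%:R <= b - a & forall w, a <= w < b -> P i w]) ->
  (m <= M * N)%N.

(** Level [i] consists of the points first hitting [u, v[ at time [i]. For [i <= m] it contains T^(m
    - i) z and the whole cell of order [i] around it. *)
Lemma first_hit_bound m z : l <= z < r ->
  (forall i, (i < m)%N -> ~ (u <= iter i f z < v)) -> u <= iter m f z < v ->
  (m < M * N.+1)%N.
Proof.
move=> zd miss hit.
apply: (MP (P := fun i w => (forall j, (j < i)%N -> ~ (u <= iter j f w < v)) /\
  u <= iter i f w < v)) => // [i j w ij [_ h] [h' _]|i im]; first exact: (h' i).
have zd' : l <= iter (m - i) f z < r by rewrite iter_fun_dom.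
have [p [q [pz qz pm pq len]]] := hitting_cell i N_gt0 BN zd'.
have lp : l <= p by move: pz => ?; lra.
have qr : q <= r by move: qz => ?; lra.
exists p, q; split => // w wd.
have zd2 : p <= iter (m - i) f z < q by move: pz qz => ? ?; lra.
split=> [j ji|].
  rewrite (hitting_side lp qr pq (ltnW ji) wd zd2) -iterD; apply: miss.
  by rewrite -[X in (_ < X)%N](subnKC (im : (i <= m)%N)) ltn_add2r.
by rewrite (hitting_side lp qr pq (leqnn i) wd zd2) -iterD subnKC.
Qed.

(** Level [i] is the image under T^i of the points of [u, v[ without return up to time [i]; a common
    point of two levels would yield a return. In particular every point of [u, v[ returns. *)
Lemma first_return_bound m z : u <= z < v ->
  (forall i, (0 < i <= m)%N -> ~ (u <= iter i f z < v)) -> (m < M * N.+1)%N.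
Proof.
move=> zuv miss.
apply: (MP (P := fun i w => exists2 w0, iter i f w0 = w & u <= w0 < v /\
  forall j, (0 < j <= i)%N -> ~ (u <= iter j f w0 < v))) => //.
  move=> i j w ij [w0 e [h _]] [w1 e' [_ h']]; apply: (h' (j - i)%N).
    by rewrite subn_gt0 ij leq_subr.
  suff -> : iter (j - i) f w1 = w0 by [].
  by apply: (can_inj (@iter_funK R T i)); rewrite -iterD subnKC ?e' ?e // ltnW.
move=> i im.
have zd : l <= z < r by have := lu; have := vr; move=> ? ?; lra.
have [p [q [pz qz pm pq len]]] := hitting_cell i N_gt0 BN zd.
have lp : l <= p by move: pz => ?; lra.
have qr : q <= r by move: qz => ?; lra.
have lt_pq : p < q by move: pz qz => ? ?; lra.
have zd2 : p <= z < q by move: pz qz => ? ?; lra.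
have [r1 r2] := unmarked_range lp lt_pq qr pq (leqnn i).
exists (iter i f p), (iter i f p + (q - p)); split => //.
  by rewrite addrC addKr.
move=> w wd; pose w0 := w - (iter i f p - p).
have w0d : p <= w0 < q by rewrite /w0; lra.
exists w0; first by rewrite (unmarked_iter lp qr pq (leqnn i) w0d) /w0; ring.
split; first by have := hitting_side lp qr pq (leq0n i) w0d zd2; rewrite /= => ->.
move=> j /andP[j0 ji]; rewrite (hitting_side lp qr pq ji w0d zd2); apply: miss.
by rewrite j0 (leq_trans ji).
Qed.

Let hits z := exists n, u <= iter n f z < v.
Let m0 := (M * N.+1)%N.

Lemma hits_bounded z : l <= z < r -> hits z ->
  exists2 n, (n < m0)%N & u <= iter n f z < v.
Proof.
move=> zd hz; have exn : exists n, u <= iter n f z < v by [].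
case: (ex_minnP exn) => n hn nmin; exists n => //.
by apply: (first_hit_bound zd) => // i i_n /nmin; rewrite leqNgt i_n.
Qed.

(** Only a point [z] of [u, v[ needs an argument: its image hits because [z] returns, by
    [first_return_bound] at [m0]. *)
Lemma hits_fun z : hits (f z) <-> hits z.
Proof.
split=> [[n h]|[[|n] h]]; first by exists n.+1; rewrite iterSr.
  apply: contrapT => nh; have := @first_return_bound m0 z h.
  rewrite ltnn => H; suff : false by []; apply: H => -[//|i] _ hi.
  by apply: nh; exists i; rewrite -iterSr.
by exists n; rewrite -iterSr.
Qed.

Lemma hits_inv z : hits (g z) <-> hits z.
Proof. by rewrite -hits_fun iet_invK. Qed.

(** Hitting is decided within [m0] steps, during which a cell of order [m0] stays on one side of [u]
    and of [v]. *)
Lemma hits_cell z : l <= z < r -> exists p,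
  [/\ l <= p <= z, p \in l :: marks T m0 C & forall w, p <= w <= z -> (hits w <-> hits z)].
Proof.
move=> zd; have [p [q [pz qz pm _ pq]]] := cell m0 C zd; exists p; split => // w wd.
have lp : l <= p by move: pz => ?; lra.
have qr : q <= r by move: qz => ?; lra.
have w2 : p <= w < q by move: wd qz => ? ?; lra.
have z2 : p <= z < q by move: pz qz => ? ?; lra.
have wd' : l <= w < r by lra.
split=> /hits_bounded-/(_ ltac:(assumption))[n nm h]; exists n.
  by rewrite (hitting_side lp qr pq (ltnW nm) z2 w2).
by rewrite (hitting_side lp qr pq (ltnW nm) w2 z2).
Qed.

(* The set of points that hit [u, v[ is invariant. Its boundary points [change]
   are finitely many, and their images under T and its inverse are boundary
   points except at separation points: this gives a connection. *)
Let change b := l < b < r /\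
  exists a, l <= a < b /\ forall w, a <= w < b -> ~ (hits w <-> hits b).

(** Hitting is constant on the cell of [b] up to [b], so [b] must be the left end of its cell. *)
Lemma change_mark b : change b -> b \in marks T m0 C.
Proof.
move=> [bd [a [ab H]]]; have [|p [pb pm Hp]] := @hits_cell b; first by lra.
have [E|E] := eqVneq p b.
  by move: pm; rewrite inE E => /orP[/eqP|//]; lra.
have pb' : p < b by rewrite lt_neqAle E; lra.
exfalso; apply: (H (Num.max a p)).
  by rewrite le_max lexx /= gt_max pb'; lra.
by apply: Hp; rewrite le_max lexx orbT /= ge_max; lra.
Qed.

(** [b] is the first point after [z1] among [z2] and the marks that disagree with [z1]. For [w]
    before [b], the left end of the cell of [w] is at most [z1] or is a mark agreeing with [z1]. *)
Lemma change_exists z1 z2 : l <= z1 -> z1 < z2 -> z2 < r ->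
  ~ (hits z1 <-> hits z2) -> exists b, change b.
Proof.
move=> lz1 z12 z2r ndiff.
pose E := [seq e <- marks T m0 C | `[< ~ (hits e <-> hits z1) >]].
have [|p [b [pz1 bz qm bm Hb]]] := @cell_exists R E l z2 z1; first by lra.
have bdiff : ~ (hits b <-> hits z1).
  move: bm; rewrite inE => /orP[/eqP->|]; first by move=> H; apply: ndiff; rewrite H.
  by rewrite mem_filter => /andP[/asboolP].
exists b; split; first by lra.
exists z1; split; first by lra.
move=> w wd wb; apply: bdiff; rewrite -wb.
have [|p' [pw pm Hp]] := @hits_cell w; first by lra.
have [p'z1|z1p'] := lerP p' z1; first by rewrite (Hp z1) //; lra.
apply: contrapT => H; apply: (Hb p'); last by lra.
rewrite mem_filter; apply/andP; split; last by move: pm; rewrite inE => /orP[/eqP|//]; lra.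
by apply/asboolP; rewrite (Hp p') //; lra.
Qed.

Lemma change_fun b : change b -> (forall j : 'I_s, (0 < j)%N -> b <> gamma j) -> change (f b).
Proof.
move=> [bd [a [ab H]]] nb; have [|j bj] := @iet_letter_ex R T b; first by lra.
have jb : gamma j < b.
  rewrite lt_neqAle; apply/andP; split; last by lra.
  apply/eqP => E; have [j0|j0] := posnP j; first by move: E; rewrite iet_gamma0 //; lra.
  exact: (nb j j0).
have fE w : gamma j <= w <= b -> f w = w + (iet_nu T j - iet_mu T j).
  by move=> wd; apply: iet_fun_on; lra.
pose a' := Num.max a (gamma j).
have [aa' ja' a'b] : [/\ a <= a', gamma j <= a' & a' < b].
  by rewrite /a' !le_max !lexx orbT gt_max jb; split => //; lra.
have fb := fE b; have fa' := fE a'.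
have fa'd : l <= f a' < r by rewrite iet_fun_dom; lra.
have fbd : l <= f b < r by rewrite iet_fun_dom; lra.
split; first by rewrite fb ?fa' in fbd fa'd *; lra.
exists (f a'); split; first by rewrite fb ?fa' in fbd fa'd *; lra.
move=> w wd; have wE : f (w - (iet_nu T j - iet_mu T j)) = w.
  rewrite fE ?subrK //; rewrite fb ?fa' in wd; lra.
rewrite -wE !hits_fun; apply: H; rewrite fb ?fa' in wd; lra.
Qed.

(** As for [change_fun], on the image intervals with left ends [f (gamma j)]. The case [j = 0] is
    excluded too, since [f l] may be an inner point. *)
Lemma change_inv b : change b -> (forall j : 'I_s, b <> f (gamma j)) -> change (g b).
Proof.
move=> [bd [a [ab H]]] nb; have [|j bj] := @iet_coletter_ex R T b; first by lra.
have jb : f (gamma j) < b.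
  rewrite lt_neqAle; apply/andP; split; last by rewrite iet_fun_gamma; lra.
  by apply/eqP => E; exact: (nb j).
have fE w : f (gamma j) <= w <= b -> g w = w - (iet_nu T j - iet_mu T j).
  by rewrite iet_fun_gamma => wd; apply: iet_inv_on; lra.
pose a' := Num.max a (f (gamma j)).
have [aa' ja' a'b] : [/\ a <= a', f (gamma j) <= a' & a' < b].
  by rewrite /a' !le_max !lexx orbT gt_max jb; split => //; lra.
have fb := fE b; have fa' := fE a'.
have fa'd : l <= g a' < r by rewrite (iter_inv_dom T 1); lra.
have fbd : l <= g b < r by rewrite (iter_inv_dom T 1); lra.
split; first by rewrite fb ?fa' in fbd fa'd *; lra.
exists (g a'); split; first by rewrite fb ?fa' in fbd fa'd *; lra.
move=> w wd; have wE : g (w + (iet_nu T j - iet_mu T j)) = w.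
  rewrite fE ?addrK //; rewrite fb ?fa' in wd; lra.
rewrite -wE !hits_inv; apply: H; rewrite fb ?fa' in wd; lra.
Qed.

(** All iterates lie in the finite list of marks, so two coincide, and injectivity cancels the
    smaller exponent. *)
Lemma change_orbit h b : (forall n, change (iter n h b)) -> injective h ->
  exists2 k, (0 < k)%N & iter k h b = b.
Proof.
move=> ch inj; apply: contrapT => nper.
pose S := [seq iter i h b | i <- iota 0 (size (marks T m0 C)).+1].
have : (size S <= size (marks T m0 C))%N.
  apply: uniq_leq_size => [|_ /mapP[i _ ->]]; last exact/change_mark/ch.
  rewrite map_inj_in_uniq ?iota_uniq // => i j _ _.
  wlog ij : i j / (i <= j)%N.
    by move=> H e; have [ij|/ltnW ij] := leqP i j; [exact: H|apply/esym/H].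
  move=> e; have [//|ne] := eqVneq i j; exfalso; apply: nper.
  exists (j - i)%N; first by rewrite subn_gt0 ltn_neqAle ne.
  have iter_inj n : injective (iter n h) by elim: n => // n IH x y /inj /IH.
  by apply: (iter_inj i); rewrite -iterD subnKC.
by rewrite size_map size_iota ltnn.
Qed.

Lemma change_gamma b : change b -> exists n (j : 'I_s), (0 < j)%N /\ iter n f b = gamma j.
Proof.
move=> cb; apply: contrapT => H.
have ch n : change (iter n f b).
  elim: n => // n IH; apply: change_fun => // j j0 e; apply: H; by exists n, j.
have [k k0 e] := change_orbit ch (can_inj (@iet_funK R T)).
have bd : l <= b < r by case: cb => ? _; lra.
by have := regular_aperiodic T_regular s_gt1 k0 bd; rewrite e eqxx.
Qed.

Lemma change_fun_gamma b : change b -> exists n (j : 'I_s), iter n.+1 f (gamma j) = b.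
Proof.
move=> cb; apply: contrapT => H.
have ch n : change (iter n g b).
  elim: n => // n IH; apply: change_inv => // j e; apply: H; exists n, j.
  by rewrite iterSr -e iter_invK.
have [k k0 e] := change_orbit ch (can_inj (@iet_invK R T)).
have bd : l <= b < r by case: cb => ? _; lra.
have := regular_aperiodic T_regular s_gt1 k0 bd.
by rewrite -{1}e iter_invK eqxx.
Qed.

(** Keane's argument: [u] hits, so if some point does not, there is a boundary point [b]. It comes
    from some [gamma i] and leads to some [gamma j], a connection. If [i = 0], the path is extended
    back to the separation point with image [l]. *)
Lemma regular_minimal z : l <= z < r -> exists2 n, (n < m0)%N & u <= iter n f z < v.
Proof.
move=> zd; apply: hits_bounded => //; apply: contrapT => nz.
have hu : hits u by exists 0%N; rewrite /= lexx uv.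
have [b cb] : exists b, change b.
  have := lu; have := vr; have := uv => uv' vr' lu'.
  have [zu|uz|E] := ltgtP z u; last by rewrite -E in hu.
    by apply: (@change_exists z u) => //; [lra|lra|tauto].
  by apply: (@change_exists u z) => //; [lra|tauto].
have [n [j [j0 e]]] := change_gamma cb.
have [n' [i e']] := change_fun_gamma cb.
have [i0|i0] := posnP i.
  have [c c0 fc] := regular_left_preimage T_regular s_gt1.
  have e2 : iter (n + n'.+2) f (gamma c) = gamma j.
    by rewrite iterD iterSr fc -(iet_gamma0 i0) e' e.
  by have := regular_connection T_regular c0 j0 e2; rewrite addnS.
have e2 : iter (n + n'.+1) f (gamma i) = gamma j by rewrite iterD e' e.
by have := regular_connection T_regular i0 j0 e2; rewrite addnS.
Qed.

End Hitting.

(** Arbitrary [u] and [v] carry no bound on conjugates. They are replaced by marks [e1] and [e2] of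
    order [N] in the first and last thirds of ]u, v[, provided by [gap_bound]. *)
Lemma hitting_time : exists2 Ch : R, 0 < Ch & forall u v z,
  l <= u -> u < v -> v <= r -> l <= z < r ->
  exists2 n, n%:R * (v - u) <= Ch & u < iter n f z < v.
Proof.
have [Cg Cg0 gap] := gap_bound; have [M MP] := harmonic_levels.
pose L := r - l; have L0 : 0 < L by rewrite subr_gt0 iet_left_lt_right.
(* With [ep = (v - u) / 3] and [N ep <= Cg + ep], one gets [N.+2 (v - u) <= 3 Cg + 9 ep <= 3 Cg + 3
   L]. *)
exists (M.+1%:R * (3 * Cg + 3 * L)); first by rewrite mulr_gt0 // addr_gt0 // mulr_gt0.
move=> u v z lu uv vr zd; pose ep := (v - u) / 3.
have ep0 : 0 < ep by rewrite /ep; lra.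
have uvE : v - u = 3 * ep by rewrite /ep; lra.
pose N := (Num.truncn (Cg / ep)).+1.
have [N1 N2] : N%:R * ep <= Cg + ep /\ Cg < N%:R * ep.
  have /andP[] := truncn_itv (ltW (divr_gt0 Cg0 ep0)).
  rewrite ler_pdivlMr // ltr_pdivrMr // -/N /N => h1 h2; split => //.
  by rewrite -natr1 mulrDl mul1r lerD2r.
have marked x : u <= x -> x + ep <= v -> exists2 e, e \in marks T N [::] & x < e < x + ep.
  move=> ux xv; apply: contrapT => H.
  have xx : x < x + ep by lra.
  have : N%:R * ((x + ep) - x) <= Cg.
    apply: (gap N x (x + ep)) => //; [lra|lra|].
    by move=> e eM ed; apply: H; exists e.
  rewrite addrC addKr; lra.
have [e1 e1m e1d] : exists2 e, e \in marks T N [::] & u < e < u + ep.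
  apply: marked => //; lra.
have [e2 e2m e2d] : exists2 e, e \in marks T N [::] & v - ep < e < v.
  have [||e em ed] := marked (v - ep); [lra|lra|].
  by exists e => //; rewrite subrK in ed.
have lat_e e : e \in marks T N [::] -> lat (N.+1%:R * kappa) (e - l).
  by move/(lat_marks (lexx 0)); rewrite addr0; apply.
have B0 : 0 <= N.+1%:R * kappa by rewrite mulr_ge0 // ltW.
have h1 : l <= e1 by lra.
have h2 : e1 < e2 by lra.
have h3 : e2 <= r by lra.
have [n nM ne] := regular_minimal h1 h2 h3 B0 (lat_e _ e1m) (lat_e _ e2m)
  (ltn0Sn N) (lexx _) MP zd.
exists n; last by lra.
apply: (@le_trans _ _ ((M * N.+2)%:R * (v - u))).
  by rewrite ler_pM2r ?subr_gt0 // ler_nat ltnW.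
have epL : v - u <= L by rewrite /L; lra.
rewrite natrM -mulrA; apply: (@le_trans _ _ (M%:R * (3 * Cg + 3 * L))).
  rewrite ler_wpM2l //; rewrite -natr1 -natr1 !mulrDl uvE in epL *.
  lra.
by rewrite ler_pM2r ?ler_nat // addr_gt0 // mulr_gt0.
Qed.
End Gaps.

(** * Equivalence classes *)

Lemma iet_equiv_sym (R : realType) (S1 S2 : iet R) : iet_equiv S1 S2 -> iet_equiv S2 S1.
Proof.
case: S1 S2 => [s1 l1 w1 p1 h1 k1] [s2 l2 w2 p2 h2 k2] [/= e [pe [c c0 ce]]].
destruct e; rewrite cast_perm_id in pe; exists erefl; split=> //; exists c^-1; first by rewrite invr_gt0.
move=> a /=; rewrite cast_ord_id; have := ce a; rewrite cast_ord_id => ->.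
by rewrite mulKf // lt0r_neq0.
Qed.

Lemma iet_equiv_trans (R : realType) (S1 S2 S3 : iet R) :
  iet_equiv S1 S2 -> iet_equiv S2 S3 -> iet_equiv S1 S3.
Proof.
case: S1 S2 S3 => [s1 l1 w1 p1 h1 k1] [s2 l2 w2 p2 h2 k2] [s3 l3 w3 p3 h3 k3].
move=> [/= e [pe [c c0 ce]]] [/= e' [pe' [c' c0' ce']]].
destruct e; destruct e'; rewrite !cast_perm_id in pe pe'.
exists erefl; split; first by rewrite /= pe pe'.
exists (c * c'); first exact: mulr_gt0.
move=> a /=; rewrite cast_ord_id; have := ce a; rewrite cast_ord_id => ->.
by have := ce' a; rewrite cast_ord_id => ->; rewrite mulrA.
Qed.

Lemma iet_class_eq (R : realType) (S1 S2 : iet R) :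
  iet_equiv S1 S2 -> iet_class S1 = iet_class S2.
Proof.
move=> e12; apply/seteqP; split => S3; rewrite /iet_class /=.
  exact/iet_equiv_trans/iet_equiv_sym.
exact: iet_equiv_trans.
Qed.

Lemma iet_equiv_ratio (R : realType) (S1 S2 : iet R) t (p : 'S_t) (F : 'I_t -> 'I_t -> R) :
  (exists e : iet_size S1 = t, cast_perm e (iet_perm S1) = p /\
     forall a b, iet_len S1 a / iet_len S1 b = F (cast_ord e a) (cast_ord e b)) ->
  (exists e : iet_size S2 = t, cast_perm e (iet_perm S2) = p /\
     forall a b, iet_len S2 a / iet_len S2 b = F (cast_ord e a) (cast_ord e b)) ->
  iet_equiv S1 S2.
Proof.
case: S1 S2 => [s1 l1 w1 p1 h1 k1] [s2 l2 w2 p2 h2 k2].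
move=> [/= e [pe F1]] [/= e' [pe' F2]].
destruct e; destruct e'; rewrite !cast_perm_id in pe pe'.
exists erefl; split; first by rewrite /= pe pe'.
pose a0 := Ordinal h1; exists (w1 a0 / w2 a0); first exact: divr_gt0.
move=> a /=; rewrite cast_ord_id.
have := F1 a a0; rewrite -(F2 a a0) => e.
have w10 : w1 a0 != 0 by rewrite lt0r_neq0.
have w20 : w2 a0 != 0 by rewrite lt0r_neq0.
by rewrite -[LHS](divfK w10) e; field.
Qed.

(** Size, permutation and table of ratios form a code in the finite type [F], and equal codes mean
    equivalence by [iet_equiv_ratio]. *)
Lemma finite_iet_classes (R : realType) (A : set (iet R)) (smax : nat) (Q : finType)
    (val : Q -> R) :
  (forall S, A S -> (iet_size S <= smax)%N /\
     forall a b, exists q, iet_len S a / iet_len S b = val q) ->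
  finite_set [set iet_class S | S in A]%classic.
Proof.
move=> HA; pose F := {t : 'I_smax.+1 & ('S_t * {ffun 'I_t * 'I_t -> Q})%type}.
pose rel S (c : F) := exists e : iet_size S = tag c,
  cast_perm e (iet_perm S) = (tagged c).1 /\ forall a b,
    iet_len S a / iet_len S b = val ((tagged c).2 (cast_ord e a, cast_ord e b)).
apply: (@sub_finite_set _ _ (\bigcup_(c in [set: F])
  [set iet_class S | S in [set S | A S /\ rel S c]])%classic).
  move=> _ [S AS <-]; have [Ss HQ] := HA S AS.
  pose t : 'I_smax.+1 := Ordinal (Ss : (iet_size S < smax.+1)%N).
  have [q qP] := choice (fun x : 'I_(iet_size S) * 'I_(iet_size S) => HQ x.1 x.2).
  pose c : F := @Tagged _ t (fun t : 'I_smax.+1 => ('S_t * {ffun 'I_t * 'I_t -> Q})%type)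
     (iet_perm S, [ffun x => q x]).
  exists c => //; exists S => //; split => //.
  exists erefl; split => // a b.
  by rewrite !cast_ord_id ffunE -qP.
apply: bigcup_finite => [|c _]; first exact: finite_finset.
have [[S0 [AS0 r0]]|H] := pselect (exists S, A S /\ rel S c).
  apply: (sub_finite_set _ (finite_set1 (iet_class S0))) => _ [S [AS rS] <-].
  apply: iet_class_eq.
  exact: (@iet_equiv_ratio _ _ _ _ (tagged c).1 (fun x y => val ((tagged c).2 (x, y))) rS r0).
apply: (@sub_finite_set _ _ set0%classic); last exact: finite_set0.
by move=> ? [S hS ?]; case: H; exists S.
Qed.

(** * Induced transformations *)

Lemma iet_pow_opp (R : realType) (T : iet R) n z : iet_pow T (- n%:Z) z = iter n (iet_inv T) z.
Proof. by case: n. Qed.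

Section Induced.
Variables (R : realType) (T : iet R).
Local Notation f := (iet_fun T).
Local Notation g := (iet_inv T).
Local Notation l := (iet_left T).
Local Notation r := (iet_right T).
Local Notation s := (iet_size T).
Local Notation gamma := (iet_gamma T).

(** If [b] were interior to its cell of order [n], a point [z] of that cell in the preceding
    interval of [S] would share the return time and the itinerary of [b], hence its letter. *)
Lemma induced_gamma u v (S : iet R) (a : 'I_(iet_size S)) :
  l <= u -> v <= r -> is_induced T u v S -> (0 < a)%N ->
  exists n, [/\ is_return_time T u v (iet_gamma S a) n, u < iet_gamma S a < v &
    iet_gamma S a \in marks T n [:: u; v]].
Proof.
move=> lu vr [Su Sv ret itin] a0; set b := iet_gamma S a.
have bu : u < b by rewrite -Su iet_gamma_gt.
have bv : b < v by have := iet_gamma_dom a; rewrite -/b Sv; lra.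
have buv : b \in `[u, v[ by rewrite in_itv /=; lra.
have [n nret _] := ret b buv; exists n; split => //; first by lra.
have [|p [q [pb qb pm _ pq]]] := @cell R T n [:: u; v] b; first by lra.
have [E|E] := eqVneq p b.
  by move: pm; rewrite inE E => /orP[/eqP|//]; lra.
have pb' : p < b by rewrite lt_neqAle E; lra.
exfalso.
have a1 : (a.-1 < iet_size S)%N by exact: leq_ltn_trans (leq_pred _) (ltn_ord a).
pose a' := Ordinal a1.
have bE : b = iet_mu S a' by apply: iet_gammaS; rewrite /= prednK.
have a'b : iet_gamma S a' < b by rewrite bE iet_muE ltrDl iet_len_gt0.
have ua' : u <= iet_gamma S a' by rewrite -Su iet_gamma_ge.
pose z := Num.max p (iet_gamma S a').
have [pz a'z zb] : [/\ p <= z, iet_gamma S a' <= z & z < b].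
  by rewrite /z !le_max !lexx orbT gt_max a'b; split => //; lra.
have lp : l <= p by lra.
have qr : q <= r by lra.
have zd : p <= z < q by lra.
have bd : p <= b < q by lra.
have zuv : z \in `[u, v[ by rewrite in_itv /=; lra.
have side i : (i <= n)%N -> (iter i f z \in `[u, v[) = (iter i f b \in `[u, v[).
  move=> i_n; rewrite !in_itv /=; congr (_ && _).
    by apply: (unmarked_side lp qr pq i_n _ zd bd); rewrite mem_head.
  by rewrite !ltNge (unmarked_side lp qr pq i_n _ zd bd) // !inE eqxx orbT.
have zret : is_return_time T u v z n.
  case: nret => [[n0 hn] nmin]; split; first by rewrite side.
  move=> m [m0 hm]; have [//|mn] := leqP n m.
  suff : (n <= m)%N by rewrite leqNgt mn.
  by apply: nmin; split => //; rewrite -side // ltnW.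
have /itin : itinerary T z n = itinerary T b n.
  apply/eq_in_map => k; rewrite mem_iota => /andP[_ kn].
  exact: (unmarked_same_letter lp qr pq kn zd bd).
move=> /(_ zuv buv zret nret).
have -> : iet_letter S z = Some a' by apply/iet_letterP; rewrite in_itv /= -bE a'z.
have -> : iet_letter S b = Some a.
  by apply/iet_letterP; rewrite in_itv /= lexx iet_muE ltrDl iet_len_gt0.
move=> [] /(congr1 val) /= E'; have := ltn_predL a; by rewrite E' ltnn a0.
Qed.

Lemma iet_fun_size1 z : s = 1%N -> f z = z.
Proof.
move=> s1; rewrite /iet_fun; case E: (iet_letter T z) => [a|//].
have aE (b : 'I_s) : b = a.
  by apply: val_inj => /=; have := ltn_ord a; have := ltn_ord b; lia.
suff -> : iet_nu T a = iet_mu T a by rewrite addrK.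
by rewrite /iet_nu /iet_mu; congr (_ + _); apply: eq_bigl => b; rewrite (aE b) !leqnn.
Qed.

Lemma induced_size1 u v (S : iet R) : s = 1%N -> l <= u -> v <= r ->
  is_induced T u v S -> (iet_size S <= 1)%N.
Proof.
move=> s1 lu vr ind; rewrite leqNgt; apply/negP => S1.
have [n [_ bd /marksP bm]] := @induced_gamma u v S (Ordinal S1) lu vr ind isT.
have fE i z : iter i f z = z by elim: i => //= i ->; exact: iet_fun_size1.
case: bm => [[i [j [_ j0 _]]]|[i [c [_ + e]]]].
  have := leq_trans (ltn_ord j) (eq_leq s1); rewrite ltnS leqn0 => /eqP E.
  by rewrite E in j0.
rewrite -e fE !inE => /orP[]/eqP E; move: bd; rewrite E; lra.
Qed.

End Induced.

(** * Bounds uniform over the admissible intervals, and finiteness *)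

Lemma int_as_ord (w : nat) (X : int) : (`|X| <= w)%N ->
  exists i : 'I_(2 * w).+1, i%:Z - w%:Z = X.
Proof.
move=> Xw; have Xb : (`|(X + w%:Z)%R| < (2 * w).+1)%N by lia.
by exists (Ordinal Xb) => /=; lia.
Qed.

Section Family.
Variables (R : realType) (T : iet R).
Local Notation f := (iet_fun T).
Local Notation g := (iet_inv T).
Local Notation l := (iet_left T).
Local Notation r := (iet_right T).
Local Notation s := (iet_size T).
Local Notation gamma := (iet_gamma T).
Variables (D d : nat).
Local Notation lat := (@lat R D d).

Lemma lat_orbit (B : R) : 0 <= B -> (forall a, lat B (iet_len T a)) ->
  exists kappa : R, [/\ 0 < kappa, forall n z, lat (n%:R * kappa) (iter n f z - z),
    forall a, lat kappa (gamma a - l) & lat kappa (r - l)].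
Proof.
move=> B0 hB; pose B' := #|{: 'I_s}|%:R * B.
have B'0 : 0 <= B' by rewrite mulr_ge0.
have sumB (P : pred 'I_s) : lat B' (l + \sum_(b | P b) iet_len T b - l).
  by rewrite addrC addKr; exact: lat_sum.
have latT z : lat (2 * B' + 1) (f z - z).
  rewrite /iet_fun; case: (iet_letter T z) => [a|]; last first.
    by rewrite subrr; apply: lat_le (lat0 _ _ _); lra.
  have -> : z + iet_nu T a - iet_mu T a - z = (iet_nu T a - l) - (iet_mu T a - l) by ring.
  by apply: lat_le (latB (sumB _) (sumB _)); lra.
(* One step is a difference of two partial sums of lengths, each bounded by [B']; the added 1 makes
   the constant positive. *)
exists (2 * B' + 1); split=> [|n z|a|]; first lra.
- elim: n => [|n IH] /=; first by rewrite subrr mul0r; exact: lat0.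
  have -> : f (iter n f z) - z = (f (iter n f z) - iter n f z) + (iter n f z - z) by ring.
  by rewrite -natr1 addrC mulrDl mul1r addrC; rewrite [X in lat X _]addrC; exact: latD.
- by apply: lat_le (sumB _); lra.
- by apply: lat_le (sumB _); lra.
Qed.

Variables (kappa Ch : R).
Hypothesis D_gt0 : (0 < D)%N.
Hypothesis d_gt0 : (0 < d)%N.
Hypothesis d_nonsquare : forall p q : int, p ^+ 2 = d%:Z * q ^+ 2 -> q = 0.
Hypothesis kappa_gt0 : 0 < kappa.
Hypothesis lat_iter : forall n z, lat (n%:R * kappa) (iter n f z - z).
Hypothesis lat_gamma : forall a, lat kappa (gamma a - l).
Hypothesis lat_right : lat kappa (r - l).
Hypothesis Ch_gt0 : 0 < Ch.
Hypothesis hitting : forall u v z, l <= u -> u < v -> v <= r -> l <= z < r ->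
  exists2 n, n%:R * (v - u) <= Ch & u < iter n f z < v.

Lemma kappa_le (m n : nat) : (m <= n)%N -> m%:R * kappa <= n%:R * kappa.
Proof. by move=> mn; have := kappa_gt0 => k0; rewrite ler_pM2r // ler_nat. Qed.

Section Bounds.
Variables (u v : R) (N : nat).
Hypotheses (lu : l <= u) (uv : u < v) (vr : v <= r).
Hypothesis N_large : forall n, n%:R * (v - u) <= Ch -> (n <= N)%N.

Lemma hitting_forward z : l <= z < r ->
  exists n, (0 < n <= N.+1)%N && (u < iter n f z < v).
Proof.
move=> zd; have [|n nCh h] := hitting lu uv vr (_ : l <= f z < r).
  by rewrite iet_fun_dom.
by exists n.+1; rewrite iterSr h andbT /= ltnS; exact: N_large.
Qed.

Lemma hitting_backward z : l <= z < r -> exists2 n, (n <= N)%N & u < iter n g z < v.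
Proof.
move=> zd; have [|n nCh h] := hitting lu uv vr (_ : l <= iter N g z < r).
  by rewrite iter_inv_dom.
have nN := N_large nCh; exists (N - n)%N; first exact: leq_subr.
by move: h; have -> : iter N g z = iter n g (iter (N - n) g z);
  rewrite ?iter_invK // -iterD subnKC.
Qed.

Lemma return_time_le z n : l <= z < r -> is_return_time T u v z n -> (n <= N.+1)%N.
Proof.
move=> zd [_ nmin]; have [m /andP[/andP[m0 mN] h]] := hitting_forward zd.
by apply: leq_trans mN; apply: nmin; split => //; rewrite in_itv /=; lra.
Qed.

(** Both minima exist by the hitting bounds, so the conditions in [iet_E] are effective and force
    [k] to be at most [N.+1] in absolute value; [gamma i] itself adds one more [kappa]. *)
Lemma lat_Div z : iet_Div T u v z -> lat (N.+2%:R * kappa) (z - l).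
Proof.
move=> [i _ [k [Ek1 Ek2] <-]]; have zd := iet_gamma_dom i.
have E2 : N.+2%:R * kappa = N.+1%:R * kappa + kappa by rewrite -[N.+2%:R]natr1; ring.
have -> : iet_pow T k (gamma i) - l =
  (iet_pow T k (gamma i) - gamma i) + (gamma i - l) by ring.
rewrite E2; apply: latD => //.
case: k Ek1 Ek2 => m Ek1 Ek2.
  have exn : exists n, (0 < n)%N && (u < iter n f (gamma i) < v).
    by have [n /andP[/andP[n0 _] h]] := hitting_forward zd; exists n; rewrite n0.
  case: (ex_minnP exn) => n /andP[n0 h] nmin.
  have nN : (n <= N.+1)%N.
    have [n' /andP[/andP[n0' n'N] h']] := hitting_forward zd.
    by apply: leq_trans n'N; apply: nmin; rewrite n0'.
  have /Ek2 mn : is_rho_plus T u v (gamma i) n.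
    split; first by rewrite in_itv.
    by move=> n' [n0' h']; apply: nmin; rewrite n0'; move: h'; rewrite in_itv.
  apply: lat_le (lat_iter m _); apply: kappa_le.
  by apply: ltnW; apply: leq_trans nN; rewrite -ltz_nat.
have exn : exists n, u < iter n g (gamma i) < v.
  by have [n _ h] := hitting_backward zd; exists n.
case: (ex_minnP exn) => n h nmin.
have nN : (n <= N)%N.
  by have [n' n'N h'] := hitting_backward zd; apply: leq_trans n'N; apply: nmin.
have /Ek1 mn : is_rho_minus T u v (gamma i) n.
  split; first by rewrite iet_pow_opp in_itv.
  by move=> n' /=; rewrite iet_pow_opp in_itv => /nmin.
have mn' : (m.+1 <= n)%N by move: mn; rewrite NegzE lerN2 lez_nat.
have -> : iet_pow T (Negz m) (gamma i) - gamma i =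
   - (iter m.+1 f (iter m.+1 g (gamma i)) - iter m.+1 g (gamma i)).
  by rewrite iter_invK /=; ring.
apply: latN; apply: lat_le (lat_iter m.+1 _); apply: kappa_le.
by rewrite (leq_trans mn') // (leq_trans nN).
Qed.

Variable S : iet R.
Hypothesis S_induced : is_induced T u v S.
Hypothesis u_Div : (iet_Div T u v `|` [set r])%classic u.
Hypothesis v_Div : (iet_Div T u v `|` [set r])%classic v.

Lemma lat_endpoints x : (iet_Div T u v `|` [set r])%classic x -> lat (N.+2%:R * kappa) (x - l).
Proof.
case=> [|->]; first exact: lat_Div.
by apply: lat_le lat_right; rewrite -[leLHS]mul1r; exact: (@kappa_le 1).
Qed.

Let A := 4 * (N.+2%:R * kappa).

(** By [induced_gamma] the point reaches a separation point of [T] or one of [u], [v] in at most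
    [N.+1] steps; one [N.+2 kappa] accounts for the steps, the other for the ends. *)
Lemma lat_induced_gamma (a : 'I_(iet_size S)) : lat (2 * (N.+2%:R * kappa)) (iet_gamma S a - l).
Proof.
have k0 := kappa_gt0.
have nk n : 0 <= n%:R * kappa by rewrite mulr_ge0 // ltW.
have [a0|a0] := posnP a.
  rewrite iet_gamma0 //; case: S_induced => -> _ _ _.
  by apply: lat_le (lat_endpoints u_Div); have := nk N.+2; lra.
have [n [nret bd bm]] := induced_gamma lu vr S_induced a0.
have lu' := lu; have vr' := vr.
have nN : (n <= N.+1)%N by apply: return_time_le nret; lra.
have hC c : c \in [:: u; v] -> lat (N.+2%:R * kappa) (c - l).
  by rewrite !inE => /orP[]/eqP->; exact: lat_endpoints.
apply: lat_le (lat_marks kappa_gt0 lat_iter lat_gamma (nk _) hC bm).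
have := @kappa_le n.+1 N.+2 nN; lra.
Qed.

Lemma lat_induced_len (a : 'I_(iet_size S)) : lat A (iet_len S a).
Proof.
have -> : iet_len S a = (iet_mu S a - l) - (iet_gamma S a - l) by rewrite iet_muE; ring.
have -> : A = 2 * (N.+2%:R * kappa) + 2 * (N.+2%:R * kappa) by rewrite /A; ring.
apply: latB; last exact: lat_induced_gamma.
have [aS|aS] := ltnP a.+1 (iet_size S).
  by rewrite -(@iet_gammaS _ S a (Ordinal aS)) //; exact: lat_induced_gamma.
rewrite iet_mu_last; last by apply/eqP; rewrite eqn_leq ltn_ord.
case: S_induced => _ -> _ _; apply: lat_le (lat_endpoints v_Div).
have : 0 <= N.+2%:R * kappa by rewrite mulr_ge0 // ltW.
lra.
Qed.

Variable W : R.
Hypothesis W_large : D%:R * (v - u) * A <= W.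

Lemma induced_sum_len : \sum_a iet_len S a = v - u.
Proof. by case: S_induced => <- <- _ _; rewrite /iet_right; ring. Qed.

(** By repulsion each length is at least [1 / (D A)], and the lengths add up to [v - u]. *)
Lemma induced_size_le : (iet_size S)%:R <= W.
Proof.
apply: le_trans W_large; rewrite -induced_sum_len mulrAC mulr_sumr.
rewrite -[X in X%:R <= _](card_ord (iet_size S)) -sum1_card natr_sum.
apply: ler_sum => a _; have a0 := iet_len_gt0 S a.
have := lat_lower D_gt0 d_nonsquare (lat_induced_len a) (lt0r_neq0 a0).
by rewrite gtr0_norm.
Qed.

Lemma induced_ratio (a b : 'I_(iet_size S)) : exists X Y Z : int,
  iet_len S a / iet_len S b = (X%:~R + Y%:~R * Num.sqrt d%:R) / Z%:~R /\
  [/\ `|X|%:~R <= W, `|Y|%:~R <= W & `|Z|%:~R <= W].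
Proof.
have A0 : 0 <= A := lat_ge0 (lat_induced_len a).
have bound c : D%:R * `|iet_len S c| * A <= W.
  apply: le_trans W_large; rewrite ler_wpM2r // ler_wpM2l //.
  rewrite gtr0_norm ?iet_len_gt0 // -induced_sum_len (bigD1 c) //= lerDl sumr_ge0 // => i _.
  exact/ltW/iet_len_gt0.
apply: (lat_ratio D_gt0 d_nonsquare d_gt0 _ (lat_induced_len a) (lat_induced_len b)) => //.
exact/lt0r_neq0/iet_len_gt0.
Qed.

End Bounds.

Lemma finite_induced_classes : finite_set [set iet_class S | S in induced_family T]%classic.
Proof.
pose L := r - l; have L0 : 0 < L by rewrite subr_gt0 iet_left_lt_right.
(* From [N (v - u) <= Ch] follows [(N + 2) (v - u) <= Ch + 2 L], so [W] bounds [D (v - u) A] for all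
   admissible intervals at once. *)
pose W := 4 * D%:R * kappa * (Ch + 2 * L).
have W0 : 0 <= W by rewrite !mulr_ge0 // ?addr_ge0 ?mulr_ge0 // ltW.
pose w := Num.truncn W.
have leW (m : nat) : m%:R <= W -> (m <= w)%N by rewrite truncn_ge_nat.
(* The integers [X], [Y], [Z] of a ratio, of absolute value at most [w], are encoded after a shift
   by [w]. *)
pose Q := ('I_(2 * w).+1 * 'I_(2 * w).+1 * 'I_(2 * w).+1)%type.
pose sh (i : 'I_(2 * w).+1) : int := i%:Z - w%:Z.
pose val (q : Q) : R := ((sh q.1.1)%:~R + (sh q.1.2)%:~R * Num.sqrt d%:R) / (sh q.2)%:~R.
have shP (X : int) : `|X|%:~R <= W -> exists i, sh i = X.
  move=> XW; have Xw : (`|X| <= w)%N by apply: leW; rewrite -abszE in XW.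
  exact: int_as_ord.
apply: (@finite_iet_classes _ _ w Q val) => S [u [v [[lu uv vr uD vD] ind]]].
pose N := Num.truncn (Ch / (v - u)).
have vu0 : 0 < v - u by rewrite subr_gt0.
have N_large n : n%:R * (v - u) <= Ch -> (n <= N)%N.
  by rewrite -ler_pdivlMr // => h; rewrite truncn_ge_nat // divr_ge0 // ltW.
have NCh : N%:R * (v - u) <= Ch.
  by rewrite -ler_pdivlMr // truncn_le divr_ge0 // ltW.
have Wl : D%:R * (v - u) * (4 * (N.+2%:R * kappa)) <= W.
  have -> : D%:R * (v - u) * (4 * (N.+2%:R * kappa)) = 4 * D%:R * kappa * (N.+2%:R * (v - u)) by ring.
  rewrite ler_wpM2l //; first by rewrite !mulr_ge0 // ltW.
  have vuL : v - u <= L by rewrite /L; lra.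
  rewrite -[N.+2%:R]natr1 -[N.+1%:R]natr1; lra.
split; first exact/leW/(induced_size_le lu uv vr N_large ind uD vD Wl).
move=> a b.
have [X [Y [Z [-> [hX hY hZ]]]]] := induced_ratio lu uv vr N_large ind uD vD Wl a b.
have [i <-] := shP X hX; have [j <-] := shP Y hY; have [k <-] := shP Z hZ.
by exists (i, j, k).
Qed.

End Family.

Local Open Scope classical_set_scope.

Theorem theorem5p1 (R : realType) (T : iet R) :
  iet_regular T -> defined_over_quadratic_field T ->
  finite_set [set iet_class S | S in induced_family T].
Proof.
move=> T_regular [d [d2 sf hd]].
(* With a single letter [T] is the identity and no hitting bound holds; but each induced
   transformation then has one letter, and 1 is the only ratio. *)
have [s_gt1|s1] := ltnP 1 (iet_size T); last first.
  have {}s1 : iet_size T = 1%N.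
    by apply/eqP; rewrite eqn_leq s1 iet_size_gt0.
  apply: (@finite_iet_classes R _ 1 unit (fun=> 1)) => S [u [v [[lu _ vr _ _] ind]]].
  have S1 := induced_size1 s1 lu vr ind; split => // a b; exists tt.
  have -> : a = b.
    apply: val_inj; have := leq_trans (ltn_ord a) S1; have := leq_trans (ltn_ord b) S1.
    by rewrite !ltnS !leqn0 => /eqP b0 /eqP a0; rewrite /= a0 b0.
  by rewrite divff // lt0r_neq0 // iet_len_gt0.
have ns := squarefree_nonsquare d2 sf.
have [D [B [D0 B0 hB]]] := quadratic_common_denominator hd.
have [kappa [k0 h1 h2 h3]] := lat_orbit B0 hB.
have [Ch Ch0 hit] := hitting_time T_regular s_gt1 D0 ns k0 h1 h2 h3.
exact: (finite_induced_classes D0 (ltnW d2) ns k0 h1 h2 h3 Ch0 hit).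
Qed.
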